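(* Let $(G_m)$ be a sequence of finite transitive graphs, where $G_m$ has vertex degree $m$ and $V_m$ vertices, satisfying the strong triangle condition (stated in the context). Consider bond percolation on $G_m$ with $p = p_c(G_m)(1-\varepsilon_m)$, where $(\varepsilon_m)$ is a non-negative sequence with $\varepsilon_m \to 0$ and $\varepsilon_m^3 V_m \to \infty$ as $m \to \infty$. Then the following assertions hold: (a) For any fixed $\alpha < 1$ and any sequence of integers $(j_m)$ such that $j_m \in [1, (\varepsilon_m^3 V_m)^\alpha]$ we have $$|\mathcal{C}_{j_m}| = \Theta\left(\varepsilon_m^{-2} \log(\varepsilon_m^3 V_m)\right) \quad \text{with high probability},$$ that is, there exist constants $C' \ge c' > 0$ such that $$\lim_{m\to\infty}\mathbb{P}_p\left(c'\varepsilon_m^{-2} \log(\varepsilon_m^3 V_m) \le |\mathcal{C}_{j_m}| \le C'\varepsilon_m^{-2} \log(\varepsilon_m^3 V_m)\right)=1.$$ (b) There exist constants $c, c_a>0$ (not depending on $m$ or $A$) such that for any $A \in [1, c\,\varepsilon_m V_m^{1/3}]$, $$\mathbb{P}_p(|\mathcal{C}| \ge A \varepsilon_m^{-2}) \ge \frac{c\, \varepsilon_m}{A} e^{-c_a A}.$$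
   Context: Bond percolation on a graph $G$ with parameter $p\in[0,1]$ is the random subgraph $G_p$ obtained by independently retaining (declaring open) each edge with probability $p$ and removing (declaring closed) it otherwise; its law is $\mathbb{P}_p$, with expectation $\mathbb{E}_p$. $\{x\leftrightarrow y\}$ is the event that $x$ and $y$ are connected by a path of open edges (with $x \leftrightarrow x$ always). $\mathcal{C}(x)=\{y: x\leftrightarrow y\}$; by transitivity the law of $|\mathcal{C}(x)|$ does not depend on $x$, and one writes $\mathcal{C}$ for $\mathcal{C}(x)$ with arbitrary fixed $x$. $\chi(p) = \mathbb{E}_p[|\mathcal{C}|]$. The critical parameter $p_c = p_c(G_m)\in[0,1]$ is the unique solution of $\chi(p_c) = \lambda V_m^{1/3}$, where $\lambda\in(0,\infty)$ is a fixed constant (constants may depend on $\lambda$). $\mathcal{C}_j$ is the $j$th largest connected component of the open subgraph (by number of vertices, ties broken arbitrarily). Strong triangle condition for $(G_m)$: there exists a constant $C>0$ such that for all $m$, any two vertices $x,y$ of $G_m$ and any $p\le p_c(G_m)$, $$\sum_{u,v} \mathbb{P}_p(x \leftrightarrow u)\, \mathbb{P}_p(u \leftrightarrow v)\, \mathbb{P}_p(v \leftrightarrow y) \le \mathbb{1}_{\{x=y\}} + C\left(\frac{\chi(p)^3}{V_m} + \frac1m \right),$$ the sum being over all vertices $u,v$ of $G_m$. *)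

(* Defs.v *)
From HB Require Import structures.
From mathcomp Require Import all_boot all_order all_fingroup all_algebra.
From mathcomp Require Import all_classical all_reals all_analysis.

Set Implicit Arguments.
Unset Strict Implicit.
Unset Printing Implicit Defensive.

Import Order.TTheory GRing.Theory Num.Theory.
Import numFieldNormedType.Exports.

Local Open Scope ring_scope.

Record sgraph := SGraph {
  vertex :> finType;
  adj : rel vertex;
  adj_sym : symmetric adj;
  adj_irrefl : irreflexive adj
}.

Definition vertex_transitive (G : sgraph) : Prop :=
  forall x y : G, exists f : {perm G},
    (forall u v : G, adj (f u) (f v) = adj u v) /\ f x = y.

Definition regular_of_degree (G : sgraph) (d : nat) : Prop :=
  forall x : G, #|[set y | adj x y]| = d.

(* An edge is the two-element set of its endpoints; a percolation
   configuration is the set of its open edges, a subset of [edges G]. *)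
Definition edges (G : sgraph) : {set {set G}} :=
  [set [set z.1; z.2] | z in [set z : G * G | adj z.1 z.2]]%SET.

Definition open_adj (G : sgraph) (w : {set {set G}}) : rel G :=
  fun x y => adj x y && ([set x; y]%SET \in w).

Definition open_connected (G : sgraph) (w : {set {set G}}) (x y : G) : bool :=
  connect (open_adj w) x y.

Definition open_cluster (G : sgraph) (w : {set {set G}}) (x : G) : {set G} :=
  [set y | open_connected w x y]%SET.

Definition open_clusters (G : sgraph) (w : {set {set G}}) : {set {set G}} :=
  [set open_cluster w x | x in [set: G]]%SET.

(* Size of the j-th largest open cluster, j >= 1 (it is 0 when there are fewer
   than j clusters). *)
Definition cluster_size (G : sgraph) (w : {set {set G}}) (j : nat) : nat :=
  nth 0%N (sort geq [seq #|A| | A : {set G} <- enum (open_clusters w)]) j.-1.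

Definition expect (R : realType) (G : sgraph) (p : R)
    (X : {set {set G}} -> R) : R :=
  \sum_(w : {set {set G}} | w \subset edges G)
     p ^+ #|w| * (1 - p) ^+ #|(edges G :\: w)%SET| * X w.

Definition prob (R : realType) (G : sgraph) (p : R)
    (E : {set {set G}} -> bool) : R :=
  expect p (fun w => (E w)%:R).

Definition susceptibility (R : realType) (G : sgraph) (o : G) (p : R) : R :=
  expect p (fun w => #|open_cluster w o|%:R).

(* Such a [q] is unique as soon as [G] is transitive and has an edge, because
   the susceptibility is then strictly increasing on [0, 1]. *)
Definition is_critical (R : realType) (lambda : R) (G : sgraph) (o : G)
    (q : R) : Prop :=
  0 <= q <= 1 /\ susceptibility o q = lambda * #|G|%:R `^ 3^-1.

(* The sequence of graphs is (G_m) for m >= m0, and [o m] is the arbitrary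
   fixed vertex of G_m at which the susceptibility is computed. *)
Definition strong_triangle (R : realType) (m0 : nat) (G : nat -> sgraph)
    (o : forall m, G m) (pc : nat -> R) : Prop :=
  exists2 C : R, 0 < C &
    forall (m : nat) (x y : G m) (p : R), (m0 <= m)%N -> 0 <= p <= pc m ->
      \sum_(u : G m) \sum_(v : G m)
          prob p (fun w => open_connected w x u) *
          prob p (fun w => open_connected w u v) *
          prob p (fun w => open_connected w v y)
      <= (x == y)%:R
         + C * (susceptibility (o m) p ^+ 3 / #|G m|%:R + m%:R^-1).

(* Main.v *)
(* Write [chi p] for the susceptibility, [C] for the cluster of the origin and
   [m] for the degree. The van den Berg-Kesten inequality and the triangle
   condition give [m chi^2 / 2 <= chi' <= m chi^2] as long as
   [chi <= l1 V^(1/3)] with [l1] small, hence [chi (pc (1 - eps)) = O(1/eps)]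
   once the window between [l1 V^(1/3)] and [lambda V^(1/3)] is shown to have
   relative width [O(V^(-1/3))].

   Exploring the cluster of a uniformly chosen vertex, the OSSS method yields
   [2 chi p (1 - p) (E h(|C|))' >= E |C| h(|C|) - chi E h(|C|)] for every
   nondecreasing [h]. With [h = id] this bounds the width of the window, and with
   [h] supported on [N, oo) it yields the tail bound [exp (- c N / chi^2)].

   Let [Z] be the sum of [1_(e open) - p] over the edges [e] touching [C]. It has
   variance at most [p (1 - p) m chi], and [p (1 - p) chi' = E |C| Z], so the
   Cauchy-Schwarz inequality gives [E |C|^2 >= chi^3 / 16]. Together with the
   tail bound this shows that [|C|] is of order [chi^2], with [|Z| = O(chi)],
   with probability of order [1 / chi]. For a lower bound on
   [P_p (|C| >= A eps^(-2))] one starts from the parameter [q >= p] where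
   [chi q^2] is of order [A eps^(-2)] and changes the measure from [q] to [p] on
   the edges touching [C], at a cost [exp (- O(A))].

   For assertion (a), the number of vertices in clusters of size at least
   [c' eps^(-2) log (eps^3 V)] concentrates by the second moment method, and no
   cluster is larger than [C' eps^(-2) log (eps^3 V)], so there must be many
   clusters of this order. *)
Require Import Defs.
From HB Require Import structures.
From mathcomp Require Import all_boot all_order all_fingroup all_algebra.
From mathcomp Require Import ring lra.

Set Implicit Arguments.
Unset Strict Implicit.
Unset Printing Implicit Defensive.

Import Order.TTheory GRing.Theory Num.Theory.

Local Open Scope ring_scope.

(** The triangle condition is used only for adjacent vertices, where its indicator vanishes and C
    (chi^3 / V + 1 / m) remains. This is at most 1/2 only while chi <= l1 V^(1/3) with l1 small,
    whereas lambda is arbitrary. Hence nothing that rests on the triangle condition reaches pc: it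
    is used up to the point [p1] where chi = l1 V^(1/3), and the interval from [p1] to pc is crossed
    with OSSS, which holds on any transitive graph, and with the monotonicity of the second moment.

    The score Z is what makes the change of measure affordable. Passing from q to q (1 - eta) on the
    edges touching a cluster of size about chi^2 could cost a factor with exponent eta m q chi^2,
    which for eta of order eps and chi of order sqrt A / eps is of order A / eps. The first-order
    terms of the log-likelihood combine into a multiple of eta Z, so once |Z| = O(chi) is imposed,
    only eta^2 chi^2 + eta chi = O(A) is left. *)

Lemma eq_ler (R : numDomainType) (x y : R) : x = y -> x <= y.
Proof. by move->. Qed.

(** * Bernoulli product measures *)

Lemma set_ind (T : finType) (P : {set T} -> Prop) :
  P set0 -> (forall e (S : {set T}), e \notin S -> P S -> P (e |: S)) -> forall S, P S.
Proof.
move=> P0 PS S; have [n] := ubnP #|S|; elim: n S => // n IH S.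
have [->//|[e eS]] := set_0Vmem S; rewrite (cardsD1 e) eS ltnS => leS.
by rewrite -(setD1K eS); apply: PS; [rewrite !inE eqxx | apply: IH].
Qed.

Section ProductMeasure.
Variables (R : realFieldType) (T : finType).
Implicit Types (p : R) (S B w : {set T}) (X Y : {set T} -> R).

(** The ground set [S] is a parameter so that edges can be conditioned on and removed one at a time;
    at [edges G] this is convertible to [expect]. *)
Definition bex p S X : R :=
  \sum_(w : {set T} | w \subset S) p ^+ #|w| * (1 - p) ^+ #|S :\: w| * X w.

Lemma eq_bex p S X Y :
  (forall w, w \subset S -> X w = Y w) -> bex p S X = bex p S Y.
Proof. by move=> eXY; apply: eq_bigr => w wS; rewrite eXY. Qed.

Lemma bexD p S X Y : bex p S (fun w => X w + Y w) = bex p S X + bex p S Y.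
Proof. by rewrite -big_split; apply: eq_bigr => w _; rewrite mulrDr. Qed.

Lemma bexZ p S c X : bex p S (fun w => c * X w) = c * bex p S X.
Proof. by rewrite mulr_sumr; apply: eq_bigr => w _; rewrite mulrCA. Qed.

Lemma bexZr p S c X : bex p S (fun w => X w * c) = bex p S X * c.
Proof. by rewrite mulrC -bexZ; apply: eq_bex => w _; rewrite mulrC. Qed.

Lemma bexB p S X Y : bex p S (fun w => X w - Y w) = bex p S X - bex p S Y.
Proof.
by rewrite -mulN1r -bexZ -bexD; apply: eq_bex => w _; rewrite mulN1r.
Qed.

Lemma bex_sum p S (I : Type) (r : seq I) (P : pred I) (F : I -> {set T} -> R) :
  bex p S (fun w => \sum_(i <- r | P i) F i w) = \sum_(i <- r | P i) bex p S (F i).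
Proof.
by rewrite exchange_big; apply: eq_bigr => w _; rewrite mulr_sumr.
Qed.

Lemma bex_set0 p X : bex p set0 X = X set0.
Proof.
rewrite /bex (big_pred1 set0) => [|w]; last by rewrite subset0.
by rewrite setD0 cards0 !expr0 !mul1r.
Qed.

Lemma bexU1 p e S X : e \notin S ->
  bex p (e |: S) X = p * bex p S (fun w => X (e |: w)) + (1 - p) * bex p S X.
Proof.
move=> eS; rewrite /bex (bigID (fun w : {set T} => e \in w)) /=; congr (_ + _).
  rewrite (reindex_onto (fun w => e |: w) (fun w => w :\ e)) /=; last first.
    by move=> w /andP[_ ew]; rewrite setD1K.
  rewrite mulr_sumr; apply: eq_big => [w|w /andP[/andP[wS _] /eqP we]].
    rewrite setU11 andbT; apply/andP/idP => [[] /subsetP wS /eqP we|wS].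
      apply/subsetP => x; rewrite -we => /setD1P[xe xw].
      by have := wS x xw; rewrite !inE (negbTE xe).
    split; first exact: setUS.
    by rewrite setU1K //; apply: contra eS => /(subsetP wS).
  have ew : e \notin w by rewrite -we !inE eqxx.
  rewrite cardsU1 ew exprS -!mulrA; do 3 congr (_ * _).
  congr (_ ^+ #|pred_of_set _|); apply/setP => x; rewrite !inE.
  by case: eqVneq => [->|] //=; rewrite (negbTE eS) andbF.
rewrite mulr_sumr; apply: eq_big => [w|w /andP[wS ew]].
  apply/andP/idP => [[/subsetP wS ew]|wS].
    apply/subsetP => x xw; have := wS x xw; rewrite !inE => /predU1P[xe|//].
    by rewrite -xe xw in ew.
  by split; [apply: subset_trans wS (subsetUr _ _) | apply: contra eS => /(subsetP wS)].
have -> : (e |: S) :\: w = e |: (S :\: w).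
  by apply/setP => x; rewrite !inE; case: eqVneq => [->|]; rewrite ?ew.
by rewrite cardsU1 !inE (negbTE eS) andbF exprS; ring.
Qed.

Lemma bexD1 p e S X : e \in S ->
  bex p S X = p * bex p (S :\ e) (fun w => X (e |: w)) + (1 - p) * bex p (S :\ e) X.
Proof. by move=> eS; rewrite -[in LHS](setD1K eS) bexU1 // !inE eqxx. Qed.

Lemma bex_cst p S c : bex p S (fun=> c) = c.
Proof.
elim/set_ind: S => [|e S eS IH]; first by rewrite bex_set0.
by rewrite bexU1 // IH; ring.
Qed.

Lemma bex_split p S S' X : [disjoint S & S'] ->
  bex p (S :|: S') X = bex p S (fun w => bex p S' (fun w' => X (w :|: w'))).
Proof.
elim/set_ind: S X => [|e S eS IH] X dS.
  by rewrite bex_set0 set0U; apply: eq_bex => w _; rewrite set0U.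
rewrite -setUA !bexU1 //; last first.
  by rewrite !inE negb_or eS (disjointFr dS) // setU11.
rewrite !IH; try by apply: disjointWl dS; apply: subsetUr.
by congr (_ * _ + _); apply: eq_bex => w _; apply: eq_bex => w' _; rewrite setUA.
Qed.

Lemma bex_indep p S B (F H : {set T} -> R) : B \subset S ->
  bex p S (fun w => F (w :&: B) * H (w :\: B)) =
  bex p B F * bex p (S :\: B) H.
Proof.
move=> BS; rewrite -[in LHS](setID S B) (setIidPr BS) bex_split; last first.
  by rewrite -setI_eq0 setIDA setIC setDIl setDv setI0.
rewrite -bexZr; apply: eq_bex => w wB; rewrite -bexZ; apply: eq_bex => w'.
rewrite subsetD => /andP[_ dw']; congr (F _ * H _).
  rewrite setIUl (setIidPl wB) [w' :&: B](_ : _ = set0) ?setU0 //.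
  by apply/eqP; rewrite setI_eq0.
rewrite setDUl; move: wB; rewrite -setD_eq0 => /eqP ->; rewrite set0U.
by apply/setDidPl.
Qed.

Lemma bex_marginal p S B (F : {set T} -> R) : B \subset S ->
  bex p S (fun w => F (w :&: B)) = bex p B F.
Proof.
move=> BS; rewrite -[RHS]mulr1 -(bex_cst p (S :\: B) 1) -bex_indep //.
by apply: eq_bex => w _; rewrite mulr1.
Qed.

Lemma bex_marginalD p S B (H : {set T} -> R) : B \subset S ->
  bex p S (fun w => H (w :\: B)) = bex p (S :\: B) H.
Proof.
move=> BS; rewrite -[RHS]mul1r -(bex_cst p B 1) -bex_indep //.
by apply: eq_bex => w _; rewrite mul1r.
Qed.

Section Order.
Variable p : R.
Hypothesis p01 : 0 <= p <= 1.

Lemma le_bex S X Y :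
  (forall w, w \subset S -> X w <= Y w) -> bex p S X <= bex p S Y.
Proof.
move=> leXY; apply: ler_sum => w wS; apply: ler_wpM2l; last exact: leXY.
by case/andP: p01 => p0 p1; rewrite mulr_ge0 ?exprn_ge0 ?subr_ge0.
Qed.

Lemma bex_ge0 S X : (forall w, w \subset S -> 0 <= X w) -> 0 <= bex p S X.
Proof. by move=> X0; rewrite -[leLHS](bex_cst p S); apply: le_bex. Qed.

Lemma bex_subset S S' X : S' \subset S ->
  (forall w w' : {set T}, w \subset w' -> X w <= X w') -> bex p S' X <= bex p S X.
Proof.
move=> sS' monoX; rewrite -(bex_marginal p X sS'); apply: le_bex => w _.
by apply: monoX; apply: subsetIl.
Qed.

End Order.

Definition incr e X w := X (e |: w) - X (w :\ e).

Lemma bex_incr p e S X : e \in S ->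
  bex p S (incr e X) = bex p (S :\ e) (fun w => X (e |: w) - X w).
Proof.
move=> eS; rewrite (bexD1 p _ eS).
have -> : bex p (S :\ e) (fun w => incr e X (e |: w)) =
    bex p (S :\ e) (fun w => X (e |: w) - X w).
  apply: eq_bex => w; rewrite subsetD1 /incr => /andP[_ ew].
  by rewrite setUA setUid setU1K.
have -> : bex p (S :\ e) (incr e X) =
    bex p (S :\ e) (fun w => X (e |: w) - X w); last by ring.
apply: eq_bex => w; rewrite subsetD1 /incr => /andP[_ ew].
by congr (_ - X _); apply/setDidPl; rewrite disjoint_sym disjoints1.
Qed.

(* Russo's formula: this sum is the derivative of [bex p S X] with respect to [p]. *)
Definition russo p S X := \sum_(e in S) bex p S (incr e X).

(** Product rule applied to [bexU1]: the initial difference comes from differentiating the weights p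
    and 1 - p of the two states of [e]. *)
Lemma russoU1 p e S X : e \notin S ->
  russo p (e |: S) X = bex p S (fun w => X (e |: w)) - bex p S X
    + p * russo p S (fun w => X (e |: w)) + (1 - p) * russo p S X.
Proof.
move=> eS; rewrite /russo big_setU1 //= bex_incr ?setU11 // setU1K // bexB -!addrA.
congr (_ + (_ + _)); rewrite !mulr_sumr -big_split; apply: eq_bigr => f fS.
have ef : f != e by apply: contraNneq eS => <-.
rewrite bexU1 //; congr (_ * _ + _); apply: eq_bex => w _; rewrite /incr.
rewrite setUCA; congr (_ - X _); apply/setP => x; rewrite !inE.
by case: (eqVneq x f) => [->|]; rewrite ?(negbTE ef).
Qed.

(** The sum of [(e \in w)%:R - p] is p (1 - p) times the logarithmic derivative in p of the weight
    of [w]. Keeping p (1 - p) on the right avoids a division, so that p = 0 and p = 1 are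
    allowed. *)
Lemma russo_score p S X : 
  bex p S (fun w => X w * \sum_(e in S) ((e \in w)%:R - p)) = p * (1 - p) * russo p S X.
Proof.
elim/set_ind: S X => [|e S eS IH] X.
  by rewrite bex_set0 /russo !big_set0 !mulr0.
rewrite bexU1 // russoU1 //.
have -> : bex p S (fun w => X (e |: w) * \sum_(f in e |: S) ((f \in e |: w)%:R - p)) =
  (1 - p) * bex p S (fun w => X (e |: w)) +
  bex p S (fun w => X (e |: w) * \sum_(f in S) ((f \in w)%:R - p)).
  rewrite -bexZ -bexD; apply: eq_bex => w wS; rewrite big_setU1 //= setU11.
  rewrite mulrDr [_ * (1 - p)]mulrC; congr (_ + _ * _); apply: eq_bigr => f fS.
  by rewrite !inE; case: eqVneq fS eS => // -> ->.
have -> : bex p S (fun w => X w * \sum_(f in e |: S) ((f \in w)%:R - p)) =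
  - p * bex p S X + bex p S (fun w => X w * \sum_(f in S) ((f \in w)%:R - p)).
  rewrite -bexZ -bexD; apply: eq_bex => w wS; rewrite big_setU1 //= mulrDr.
  have /negbTE -> : e \notin w by apply: contra eS => /(subsetP wS).
  by rewrite sub0r [_ * - p]mulrC.
by rewrite !IH; ring.
Qed.

(* The BK inequality in functional form; the induction on the edge [e] uses
   [1_(A \/ B) <= 1_A + 1_B - 1_C] for [C] contained in both [A] and [B]. *)
Lemma bk p S (Q : {set T} -> {set T} -> bool) : 0 <= p <= 1 ->
  (forall u u' v v' : {set T}, u \subset u' -> v \subset v' -> Q u v -> Q u' v') ->
  bex p S (fun w => [exists w1 : {set T}, (w1 \subset w) && Q w1 (w :\: w1)]%:R) <=
  bex p S (fun w => bex p S (fun w' => (Q w w')%:R)).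
Proof.
move=> p01; elim/set_ind: S Q => [|e S eS IH] Q mQ.
  rewrite !bex_set0 ler_nat; case: existsP => // -[w /andP[w0]].
  rewrite set0D; move: w0; rewrite subset0 => /eqP ->.
  by move=> ->.
pose Q10 u v := Q (e |: u) v; pose Q01 u v := Q u (e |: v).
pose Qo u v := Q10 u v || Q01 u v.
have sub1 (u : {set T}) : u \subset e |: u by apply: subsetUr.
have mQo (u u' v v' : {set T}) : u \subset u' -> v \subset v' -> Qo u v -> Qo u' v'.
  move=> uu vv /orP[] q; apply/orP; [left|right].
    by apply: mQ q => //; apply: setUS.
  by apply: mQ q => //; apply: setUS.
have p0 : 0 <= p by case/andP: p01.
have p1 : 0 <= 1 - p by case/andP: p01 => _; rewrite subr_ge0.
pose bx (Q : {set T} -> {set T} -> bool) w :=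
  [exists w1 : {set T}, (w1 \subset w) && Q w1 (w :\: w1)]%:R : R.
(* With [e] open, either the part [w1] of the witness contains [e] or the complementary part may use
   it; [Qo] allows both. *)
have L1 : bex p S (fun w => bx Q (e |: w)) <= bex p S (bx Qo).
  apply: le_bex => // w wS; have ew : e \notin w by apply: contra eS => /(subsetP wS).
  rewrite ler_nat; case: existsP => // -[w1 /andP[w1s q]]; rewrite lt0b.
  apply/existsP; exists (w1 :\ e); apply/andP; split.
    apply/subsetP => x /setD1P[xe xw1]; have := subsetP w1s x xw1.
    by rewrite !inE (negbTE xe).
  apply/orP; have [ew1|ew1] := boolP (e \in w1); [left|right].
    rewrite /Q10 setD1K //; apply: mQ q => //.
    apply/subsetP => x; rewrite !inE; case: eqVneq => [->|] //=.
    by rewrite ew1.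
  rewrite /Q01; apply: mQ q.
    by apply/subsetP => x; rewrite !inE; case: eqVneq => [->|] //=; rewrite (negbTE ew1).
  by apply/subsetP => x; rewrite !inE; case: eqVneq => [->|].
rewrite bexU1 //.
rewrite [leRHS]bexU1 //.
under [X in _ <= p * X + _]eq_bex => w _ do rewrite bexU1 //.
under [X in _ <= _ + _ * X]eq_bex => w _ do rewrite bexU1 //.
rewrite !bexD !bexZ.
set r11 := bex p S (fun w => bex p S (fun w' => (Q (e |: w) (e |: w'))%:R)).
set r10 := bex p S (fun w => bex p S (fun w' => (Q (e |: w) w')%:R)).
set r01 := bex p S (fun w => bex p S (fun w' => (Q w (e |: w'))%:R)).
set r00 := bex p S (fun w => bex p S (fun w' => (Q w w')%:R)).
have b0 : bex p S (bx Q) <= r00 by apply: IH.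
set u := bex p S (fun w => bex p S (fun w' => (Qo w w')%:R)).
have b1 : bex p S (fun w => bx Q (e |: w)) <= u.
  exact: le_trans L1 (IH _ mQo).
have b2 : u + r00 <= r10 + r01.
  rewrite -!bexD; apply: le_bex => // w _; rewrite -!bexD; apply: le_bex => // w' _.
  have : Q w w' -> Q10 w w' && Q01 w w'.
    by move=> q; apply/andP; split; apply: mQ q.
  rewrite /Qo /Q10 /Q01.
  case: (Q w w') => [/(_ isT)/andP[-> ->]|_] /=; first lra.
  by case: (Q (e |: w) w'); case: (Q w (e |: w')) => /=; lra.
have b3 : u <= r11.
  apply: le_bex => // w _; apply: le_bex => // w' _; rewrite ler_nat.
  have [|//] := boolP (Qo w w') => /orP[] q; rewrite lt0b; apply: mQ q => //.
(* Split [p * u] as [p * p * u + p * (1 - p) * u]; bound the first [u] by [r11] and the second by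
   [r10 + r01 - r00]. *)
have {}b1 := ler_wpM2l p0 b1.
have {}b2 := ler_wpM2l (mulr_ge0 p0 p1) b2.
have {}b3 := ler_wpM2l (mulr_ge0 p0 p0) b3.
have {}b0 := ler_wpM2l p1 b0.
rewrite -/(bx Q) in b0 b1 *.
by apply: le_trans (lerD b1 b0) _; lra.
Qed.

End ProductMeasure.

(** * Cluster exploration *)

Lemma incrU1 (R : realFieldType) (T : finType) (e f : T) (X : {set T} -> R) w :
  f != e -> incr f (fun w => X (e |: w)) w = incr f X (e |: w).
Proof.
move=> fe; rewrite /incr setUCA; congr (_ - X _); apply/setP => x; rewrite !inE.
by case: (eqVneq x f) => [->|]; rewrite ?(negbTE fe).
Qed.

Section Cluster.
Variable G : sgraph.
Implicit Types (w E : {set {set G}}) (A B : {set G}) (x y z a b : G).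

Definition reach w A : {set G} :=
  [set y | [exists x in A, open_connected w x y]].

Lemma open_connected_sym w : connect_sym (open_adj w).
Proof.
apply: sym_connect_sym => x y.
by rewrite /open_adj adj_sym setUC.
Qed.

Lemma sub_reach w A : A \subset reach w A.
Proof.
by apply/subsetP => x xA; rewrite inE; apply/existsP; exists x; rewrite xA; apply: connect0.
Qed.

Lemma reach_closed w A y z : y \in reach w A -> open_adj w y z -> z \in reach w A.
Proof.
rewrite !inE => /existsP[x /andP[xA xy]] yz; apply/existsP; exists x.
by rewrite xA; apply: connect_trans xy (connect1 yz).
Qed.

Lemma reach_min w A B : A \subset B ->
  (forall y z, y \in B -> open_adj w y z -> z \in B) -> reach w A \subset B.
Proof.
move=> /subsetP AB cB; apply/subsetP => y; rewrite inE => /existsP[x /andP[xA]].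
move=> /connectP[s sp ->]; have xB := AB _ xA; elim: s x xB sp {xA} => //= z s IH x xB /andP[xz].
by apply: IH; apply: cB xz.
Qed.

Lemma reachS w w' A A' : w \subset w' -> A \subset A' ->
  reach w A \subset reach w' A'.
Proof.
move=> /subsetP ww AA; apply: reach_min; first exact: subset_trans (sub_reach _ _).
move=> y z yr /andP[yz yzw]; apply: reach_closed yr _.
by rewrite /open_adj yz ww.
Qed.

Lemma reach1 w x : reach w [set x] = open_cluster w x.
Proof.
apply/setP => y; rewrite !inE; apply/existsP/idP => [[z /andP[]]|xy].
  by rewrite inE => /eqP ->.
by exists x; rewrite inE eqxx.
Qed.

Lemma open_clusterS w w' x : w \subset w' ->
  open_cluster w x \subset open_cluster w' x.
Proof. by move=> ww; rewrite -!reach1; apply: reachS. Qed.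

Lemma open_cluster_refl w x : x \in open_cluster w x.
Proof. by rewrite inE; apply: connect0. Qed.

Lemma open_cluster_min w x B : x \in B ->
  (forall y z, y \in B -> open_adj w y z -> z \in B) -> open_cluster w x \subset B.
Proof. by move=> xB; rewrite -reach1; apply: reach_min; rewrite sub1set. Qed.

(** The inductive step of every exploration below: an open edge leaving [A] is traded for a larger
    starting set, and the edge leaves the ground set. *)
Lemma reach_setU1 w A a b : a \in A -> adj a b ->
  reach ([set a; b] |: w) A = reach w (b |: A).
Proof.
move=> aA ab; apply/eqP; rewrite eqEsubset; apply/andP; split.
  apply: reach_min; first exact: subset_trans (subsetUr _ _) (sub_reach _ _).
  move=> y z yr /andP[yz]; rewrite in_setU1 => /predU1P[E|yzw]; last first.
    by apply: reach_closed yr _; rewrite /open_adj yz.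
  apply: (subsetP (sub_reach _ _)).
  have : z \in [set a; b] by rewrite -E !inE eqxx orbT.
  by rewrite !inE => /orP[/eqP ->|->] //; rewrite aA orbT.
apply: reach_min.
  rewrite subUset sub_reach andbT sub1set.
  apply: (@reach_closed _ _ a); first exact: (subsetP (sub_reach _ _)).
  by rewrite /open_adj ab setU11.
move=> y z yr /andP[yz yzw]; apply: reach_closed yr _.
by rewrite /open_adj yz in_setU1 yzw orbT.
Qed.

Lemma edgesP e : reflect (exists a b, adj a b /\ e = [set a; b]) (e \in edges G).
Proof.
apply: (iffP imsetP) => [[[a b]]|[a [b [ab ->]]]].
  by rewrite inE => ab ->; exists a, b.
by exists (a, b); rewrite ?inE.
Qed.

(** The edges touching the final explored set are exactly those whose state the exploration
    reveals. *)
Definition touches (e A : {set G}) := ~~ [disjoint e & A].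

Lemma touchesS (e A A' : {set G}) : A \subset A' -> touches e A -> touches e A'.
Proof. by move=> AA; apply: contra; apply: disjointWr. Qed.

Lemma touches2 a b A : touches [set a; b] A = (a \in A) || (b \in A).
Proof.
rewrite /touches; apply/pred0Pn/orP => [[x /= /andP[]]|[] h].
- by rewrite !inE => /orP[] /eqP ->; [left | right].
- by exists a; rewrite /= !inE eqxx.
- by exists b; rewrite /= !inE eqxx orbT.
Qed.

Definition touch E A := [set e in E | touches e A].

Lemma explore_case E A : E \subset edges G ->
  (touch E A = set0 /\ forall w, w \subset E -> reach w A = A) \/
  exists a b, [/\ adj a b, a \in A & [set a; b] \in E].
Proof.
move=> EG; have [/existsP[a /existsP[b /and3P[]]]|no] :=
  boolP [exists a, exists b, [&& adj a b, a \in A & [set a; b] \in E]].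
  by right; exists a, b.
left; split.
  apply/setP => e; rewrite !inE; apply/andP => -[eE]; have /edgesP[a [b [ab ee]]] := subsetP EG e eE.
  rewrite ee touches2 => abA; case/negP: no; case/orP: abA => [aA|bA].
    by apply/existsP; exists a; apply/existsP; exists b; rewrite ab aA -ee.
  by apply/existsP; exists b; apply/existsP; exists a; rewrite adj_sym ab bA setUC -ee.
move=> w /subsetP wE; apply/eqP; rewrite eqEsubset sub_reach andbT.
apply: reach_min => // y z yA /andP[yz yzw]; case/negP: no.
by apply/existsP; exists y; apply/existsP; exists z; rewrite yz yA wE.
Qed.

End Cluster.

Section Exploration.
Variables (R : realFieldType) (G : sgraph) (p : R).
Hypothesis p01 : 0 <= p <= 1.
Implicit Types (w E : {set {set G}}) (A B : {set G}) (x y z a b : G).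

(* Revealing one edge [e] at the boundary of the explored set splits
   [f g] as [f h + f (g - h)], where [h] averages [g] over [e]. *)
Lemma osss E A (phi : {set G} -> R) (g : {set {set G}} -> R) :
  E \subset edges G -> (forall B, 0 <= phi B <= 1) ->
  (forall w w', w \subset w' -> g w <= g w') ->
  bex p E (fun w => phi (reach w A) * g w) <=
  bex p E (fun w => phi (reach w A)) * bex p E g +
  p * (1 - p) * \sum_(e in E)
     bex p E (fun w => (touches e (reach w A))%:R) * bex p E (incr e g).
Proof.
move=> EG phi01; have [n] := ubnP #|E|; elim: n => // n IH in E EG A g * => leE mg.
have [p0 p1] : 0 <= p /\ 0 <= 1 - p.
  by case/andP: p01 => ? ?; rewrite subr_ge0.
have incr0 e : 0 <= bex p E (incr e g).
  apply: bex_ge0 => // w _; rewrite subr_ge0; apply: mg.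
  exact: subset_trans (subsetDl _ _) (subsetUr _ _).
case: (explore_case A EG) => [[_ rE]|[a [b [ab aA abE]]]].
  have -> : bex p E (fun w => phi (reach w A) * g w) = phi A * bex p E g.
    by rewrite -bexZ; apply: eq_bex => w /rE ->.
  have -> : bex p E (fun w => phi (reach w A)) = phi A.
    by rewrite -[RHS](bex_cst p E); apply: eq_bex => w /rE ->.
  rewrite lerDl mulr_ge0 ?mulr_ge0 // sumr_ge0 // => e _.
  by rewrite mulr_ge0 // bex_ge0.
set e := [set a; b] in abE; pose E' := E :\ e.
have E'G : E' \subset edges G by apply: subset_trans (subsetDl _ _) EG.
have leE' : (#|E'| < n)%N.
  by move: leE; rewrite (cardsD1 e) abE.
pose h w := p * g (e |: w) + (1 - p) * g w.
have mh w w' : w \subset w' -> h w <= h w'.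
  by move=> ww; apply: lerD; apply: ler_wpM2l => //; apply: mg => //; apply: setUS.
have re w : reach (e |: w) A = reach w (b |: A) by apply: reach_setU1.
have hE : bex p E g = bex p E' h by rewrite (bexD1 p _ abE) -!bexZ -bexD.
have incrE f : f \in E' -> bex p E (incr f g) = bex p E' (incr f h).
  rewrite in_setD1 => /andP[fe fE]; rewrite (bexD1 p _ abE) -!bexZ -bexD.
  apply: eq_bex => w _; rewrite -incrU1 // /incr /h; ring.
have tE f : bex p E (fun w => (touches f (reach w A))%:R) =
  p * bex p E' (fun w => (touches f (reach w (b |: A)))%:R) +
  (1 - p) * bex p E' (fun w => (touches f (reach w A))%:R).
  by rewrite (bexD1 p _ abE); congr (_ * _ + _); apply: eq_bex => w _; rewrite re.
have te : bex p E (fun w => (touches e (reach w A))%:R) = 1.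
  rewrite -[RHS](bex_cst p E); apply: eq_bex => w _.
  rewrite (@touchesS _ _ A) ?sub_reach // touches2 aA //.
rewrite (big_setD1 e) //= te mul1r.
have -> : \sum_(f in E') bex p E (fun w => (touches f (reach w A))%:R) * bex p E (incr f g)
  = p * \sum_(f in E') bex p E' (fun w => (touches f (reach w (b |: A)))%:R) * bex p E' (incr f h)
  + (1 - p) * \sum_(f in E') bex p E' (fun w => (touches f (reach w A))%:R) * bex p E' (incr f h).
  rewrite !mulr_sumr -big_split; apply: eq_bigr => f fE /=.
  by rewrite tE incrE //; ring.
have IH1 := ler_wpM2l p0 (IH E' E'G (b |: A) h leE' mh).
have IH0 := ler_wpM2l p1 (IH E' E'G A h leE' mh).
rewrite hE (bexD1 p (fun w => phi _) abE).
under [X in _ <= (p * X + _) * _ + _]eq_bex => w _ do rewrite re.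
apply: le_trans (_ : p * (1 - p) * bex p E (incr e g) +
  (p * bex p E' (fun w => phi (reach w (b |: A)) * h w) +
   (1 - p) * bex p E' (fun w => phi (reach w A) * h w)) <= _); last first.
  by apply: le_trans (lerD (lexx _) (lerD IH1 IH0)) _; apply: eq_ler; ring.
rewrite (bexD1 p _ abE) bex_incr // -/E' -!bexZ -!bexD.
apply: le_bex => // w _; rewrite re /h.
have d0 : 0 <= g (e |: w) - g w by rewrite subr_ge0; apply: mg; apply: subsetUr.
(* Revealing [e] contributes p (1 - p) (g (e |: w) - g w) (f1 - f0) to the covariance, and f1 - f0
   <= 1. The term of [e] in the sum pays for it, since [e] touches [A] and so is revealed with
   probability 1. *)
set f1 := phi _; set f0 := phi (reach w A).
have : 0 <= p * (1 - p) * (g (e |: w) - g w) * (1 - f1 + f0).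
  rewrite !mulr_ge0 // addr_ge0 ?subr_ge0 //; first by case/andP: (phi01 (reach w (b |: A))).
  by case/andP: (phi01 (reach w A)).
by move=> H; rewrite -subr_ge0; apply: le_trans H _; apply: eq_ler; ring.
Qed.

Definition score q E B w := \sum_(e in touch E B) ((e \in w)%:R - q : R).

Lemma score_U1 E A e w : w \subset E :\ e -> e \in E -> touches e A ->
  forall A' w', A \subset A' -> w = w' :\ e ->
  score p E (reach w A') w' = (e \in w')%:R - p + score p (E :\ e) (reach w A') w.
Proof.
move=> wE eE eA A' w' AA ww; rewrite /score (big_setD1 e) /=; last first.
  by rewrite inE eE (touchesS (sub_reach _ _)) // (touchesS AA).
congr (_ + _); apply: eq_big => [f|f]; first by rewrite !inE; case: eqP.
by rewrite ww !inE => /andP[-> _].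
Qed.

Lemma score_open E A a b w : w \subset E :\ [set a; b] -> [set a; b] \in E ->
  a \in A -> adj a b ->
  score p E (reach ([set a; b] |: w) A) ([set a; b] |: w) =
  1 - p + score p (E :\ [set a; b]) (reach w (b |: A)) w.
Proof.
move=> wE eE aA ab; rewrite reach_setU1 // (@score_U1 _ A [set a; b]) ?setU11 //.
- by rewrite touches2 aA.
- exact: subsetUr.
by rewrite setU1K //; move: wE; rewrite subsetD1 => /andP[].
Qed.

Lemma score_closed E A a b w : w \subset E :\ [set a; b] -> [set a; b] \in E ->
  a \in A -> adj a b ->
  score p E (reach w A) w = - p + score p (E :\ [set a; b]) (reach w A) w.
Proof.
move=> wE eE aA ab; have ew : [set a; b] \notin w.
  by move: wE; rewrite subsetD1 => /andP[].
rewrite (@score_U1 _ A [set a; b]) ?(negbTE ew) ?sub0r //.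
  by rewrite touches2 aA.
by apply/esym/setDidPl; rewrite disjoint_sym disjoints1.
Qed.

Lemma bex_score0 E : bex p E (fun w => \sum_(e in E) ((e \in w)%:R - p)) = 0.
Proof.
have := russo_score p E (fun=> 1); under eq_bex => w _ do rewrite mul1r.
move=> ->; rewrite /russo big1 ?mulr0 // => e _; rewrite -[RHS](bex_cst p E).
by apply: eq_bex => w _; rewrite /incr subrr.
Qed.

Lemma score_set0 E A w : touch E A = set0 -> score p E A w = 0.
Proof. by move=> t0; rewrite /score t0 big_set0. Qed.

(** Given the explored set, the edges not touching it are still unrevealed and centred, so only the
    touching edges correlate with a function of that set. *)
Lemma bex_phi_score E A (phi : {set G} -> R) : E \subset edges G ->
  bex p E (fun w => phi (reach w A) * \sum_(e in E) ((e \in w)%:R - p)) =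
  bex p E (fun w => phi (reach w A) * score p E (reach w A) w).
Proof.
move=> EG; have [n] := ubnP #|E|; elim: n => // n IH in E EG A * => leE.
case: (explore_case A EG) => [[t0 rE]|[a [b [ab aA abE]]]].
  transitivity (0 : R).
    transitivity (phi A * bex p E (fun w => \sum_(e in E) ((e \in w)%:R - p))).
      by rewrite -bexZ; apply: eq_bex => w wE; rewrite rE.
    by rewrite bex_score0 mulr0.
  rewrite -[LHS](bex_cst p E); apply: eq_bex => w wE.
  by rewrite rE // score_set0 // mulr0.
set e := [set a; b] in abE.
have E'G : E :\ e \subset edges G by apply: subset_trans (subsetDl _ _) EG.
have leE' : (#|E :\ e| < n)%N by move: leE; rewrite (cardsD1 e) abE.
rewrite !(bexD1 p _ abE); congr (_ * _ + _ * _).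
  transitivity (bex p (E :\ e) (fun w => (1 - p) * phi (reach w (b |: A)) +
     phi (reach w (b |: A)) * \sum_(f in E :\ e) ((f \in w)%:R - p))).
    apply: eq_bex => w wE; rewrite reach_setU1 // (big_setD1 e) //= setU11 mulrDr.
    rewrite [_ * (1 - p)]mulrC; congr (_ + _ * _); apply: eq_bigr => f.
    by rewrite !inE => /andP[/negbTE ->].
  rewrite bexD IH // -bexD; apply: eq_bex => w wE; rewrite score_open // reach_setU1 //.
  by rewrite mulrDr [_ * (1 - p)]mulrC.
transitivity (bex p (E :\ e) (fun w => - p * phi (reach w A) +
     phi (reach w A) * \sum_(f in E :\ e) ((f \in w)%:R - p))).
  apply: eq_bex => w; rewrite subsetD1 => /andP[wE ew].
  by rewrite (big_setD1 e) //= (negbTE ew) sub0r mulrDr [_ * - p]mulrC.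
rewrite bexD IH // -bexD; apply: eq_bex => w wE.
by rewrite (@score_closed E A a b) // mulrDr [_ * - p]mulrC.
Qed.

Lemma bex_score_reach0 E A : E \subset edges G ->
  bex p E (fun w => score p E (reach w A) w) = 0.
Proof.
move=> EG; have := @bex_phi_score E A (fun=> 1) EG.
under eq_bex => w _ do rewrite mul1r.
by rewrite bex_score0 => ->; apply: eq_bex => w _; rewrite mul1r.
Qed.

Lemma card_touchU1 E A A' a b w : [set a; b] \in E -> a \in A -> A \subset A' ->
  #|touch E (reach w A')| = #|touch (E :\ [set a; b]) (reach w A')|.+1.
Proof.
move=> abE aA AA; rewrite (cardsD1 [set a; b]) inE abE.
rewrite (@touchesS _ _ A) ?touches2 ?aA //; last exact: subset_trans (sub_reach _ _).
by congr (#|pred_of_set _|.+1); apply/setP => f; rewrite !inE andbA.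
Qed.

(** Wald's second identity: along the exploration the score is a martingale, and each revealed edge
    adds an increment of conditional variance p (1 - p). *)
Lemma bex_score_sqr E A : E \subset edges G ->
  bex p E (fun w => score p E (reach w A) w ^+ 2) =
  p * (1 - p) * bex p E (fun w => #|touch E (reach w A)|%:R).
Proof.
move=> EG; have [n] := ubnP #|E|; elim: n => // n IH in E EG A * => leE.
case: (explore_case A EG) => [[t0 rE]|[a [b [ab aA abE]]]].
  transitivity (0 : R).
    rewrite -[RHS](bex_cst p E); apply: eq_bex => w wE.
    by rewrite rE // score_set0 // expr0n.
  rewrite -(mulr0 (p * (1 - p))) -(bex_cst p E 0) -!bexZ; apply: eq_bex => w wE.
  by rewrite rE // t0 cards0.
set e := [set a; b] in abE.
have E'G : E :\ e \subset edges G by apply: subset_trans (subsetDl _ _) EG.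
have leE' : (#|E :\ e| < n)%N by move: leE; rewrite (cardsD1 e) abE.
rewrite !(bexD1 p _ abE).
have -> : bex p (E :\ e) (fun w => score p E (reach (e |: w) A) (e |: w) ^+ 2) =
  (1 - p) ^+ 2 + p * (1 - p) * bex p (E :\ e) (fun w => #|touch (E :\ e) (reach w (b |: A))|%:R).
  rewrite -IH // -[(1 - p) ^+ 2](bex_cst p (E :\ e)) -[RHS]addr0.
  (* The inserted zero is the mean of the cross term of the square, by [bex_score_reach0]. *)
  rewrite -(mulr0 (2 * (1 - p))) -(bex_score_reach0 (b |: A) E'G) -bexZ -!bexD.
  by apply: eq_bex => w wE; rewrite score_open //; ring.
have -> : bex p (E :\ e) (fun w => score p E (reach w A) w ^+ 2) =
  p ^+ 2 + p * (1 - p) * bex p (E :\ e) (fun w => #|touch (E :\ e) (reach w A)|%:R).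
  rewrite -IH // -[p ^+ 2](bex_cst p (E :\ e)) -[RHS]addr0.
  rewrite -(mulr0 (- 2 * p)) -(bex_score_reach0 A E'G) -bexZ -!bexD.
  by apply: eq_bex => w wE; rewrite (@score_closed E A a b) //; ring.
have ex1D X : 1 + bex p (E :\ e) X = bex p (E :\ e) (fun w => 1 + X w).
  by rewrite bexD bex_cst.
have -> : bex p (E :\ e) (fun w => #|touch E (reach (e |: w) A)|%:R) =
  1 + bex p (E :\ e) (fun w => #|touch (E :\ e) (reach w (b |: A))|%:R).
  rewrite ex1D; apply: eq_bex => w wE.
  by rewrite reach_setU1 // (card_touchU1 w abE aA) ?subsetUr // -natr1 addrC.
have -> : bex p (E :\ e) (fun w => #|touch E (reach w A)|%:R) =
  1 + bex p (E :\ e) (fun w => #|touch (E :\ e) (reach w A)|%:R).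
  rewrite ex1D; apply: eq_bex => w wE.
  by rewrite (card_touchU1 w abE aA) // -natr1 addrC.
by ring.
Qed.

End Exploration.

(** * Conditioning on the cluster of a vertex *)

Section DomainMarkov.
Variables (R : realFieldType) (G : sgraph).
Implicit Types (p q : R) (w E : {set {set G}}) (A B : {set G}) (x y z a b o : G).

Lemma touch_sub E A : touch E A \subset E.
Proof. by apply/subsetP => e; rewrite inE => /andP[]. Qed.

(** The event that the cluster equals [B] is thus measurable with respect to the edges touching [B],
    which yields all the independence used below. *)
Lemma open_cluster_touch E w o B : w \subset E ->
  (open_cluster w o == B) = (open_cluster (w :&: touch E B) o == B).
Proof.
move=> /subsetP wE; have cB y z : y \in B -> open_adj w y z ->
    open_adj (w :&: touch E B) y z.
  move=> yB /andP[yz yzw]; rewrite /open_adj yz inE yzw inE wE //=.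
  by rewrite touches2 yB.
have sw : open_cluster (w :&: touch E B) o \subset open_cluster w o.
  by apply: open_clusterS; apply: subsetIl.
have cl v y z : y \in open_cluster v o -> open_adj v y z -> z \in open_cluster v o.
  by rewrite -!reach1; apply: reach_closed.
apply/eqP/eqP => Ew; apply/eqP; rewrite eqEsubset; apply/andP; split.
- by move: sw; rewrite Ew.
- have : open_cluster w o \subset open_cluster (w :&: touch E B) o; last by rewrite Ew.
  apply: open_cluster_min; first exact: open_cluster_refl.
  move=> y z yr yz; apply: (cl _ _ _ yr); apply: cB yz.
  by rewrite -Ew; apply: (subsetP sw).
- apply: open_cluster_min; first by rewrite -Ew open_cluster_refl.
  move=> y z yB yz; rewrite -Ew; apply: cl (cB _ _ yB yz).
  by rewrite Ew.
- by move: sw; rewrite Ew.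
Qed.

Lemma split_cluster w o (X : {set G} -> R) :
  X (open_cluster w o) = \sum_B (open_cluster w o == B)%:R * X B.
Proof.
rewrite (bigD1 (open_cluster w o)) //= eqxx mul1r big1 ?addr0 // => B.
by rewrite eq_sym => /negbTE ->; rewrite mul0r.
Qed.

(** After splitting over the value [B] of the cluster, the event and the edges not touching [B] are
    independent, so the latter can be resampled. *)
Lemma domain_markov p E o (Phi : {set G} -> {set {set G}} -> R) :
  bex p E (fun w => Phi (open_cluster w o) (w :\: touch E (open_cluster w o))) =
  bex p E (fun w => bex p E (fun w' =>
     Phi (open_cluster w o) (w' :\: touch E (open_cluster w o)))).
Proof.
have -> : bex p E (fun w => Phi (open_cluster w o) (w :\: touch E (open_cluster w o))) =
   \sum_B bex p E (fun w => (open_cluster (w :&: touch E B) o == B)%:R *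
      Phi B (w :\: touch E B)).
  rewrite -bex_sum; apply: eq_bex => w wE.
  rewrite (split_cluster w o (fun B => Phi B (w :\: touch E B))).
  by apply: eq_bigr => B _; rewrite -open_cluster_touch.
have -> : bex p E (fun w => bex p E (fun w' =>
    Phi (open_cluster w o) (w' :\: touch E (open_cluster w o)))) =
  \sum_B bex p E (fun w => (open_cluster (w :&: touch E B) o == B)%:R) *
    bex p E (fun w' => Phi B (w' :\: touch E B)).
  under [RHS]eq_bigr => B _ do rewrite -bexZr.
  rewrite -bex_sum; apply: eq_bex => w wE.
  rewrite (split_cluster w o (fun B => bex p E (fun w' => Phi B (w' :\: touch E B)))).
  by apply: eq_bigr => B _; rewrite -open_cluster_touch.
apply: eq_bigr => B _; have tE := touch_sub E B.
rewrite (bex_indep p (fun w => (open_cluster w o == B)%:R)) //.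
by rewrite -(bex_marginal p _ tE) -(bex_marginalD p _ tE).
Qed.

(** The event depends only on the cluster and the edges touching it, so the likelihoods need to be
    compared on those edges alone; all others integrate to 1 under both parameters. *)
Lemma change_of_measure p q E o c (K : {set G} -> {set {set G}} -> bool) :
  0 <= p <= 1 ->
  (forall w, w \subset E -> let B := open_cluster w o in let T := touch E B in
    K B (w :&: T) -> c * (q ^+ #|w :&: T| * (1 - q) ^+ #|T :\: w|) <=
      p ^+ #|w :&: T| * (1 - p) ^+ #|T :\: w|) ->
  c * bex q E (fun w => (K (open_cluster w o) (w :&: touch E (open_cluster w o)))%:R)
  <= bex p E (fun w => (K (open_cluster w o) (w :&: touch E (open_cluster w o)))%:R).
Proof.
move=> p01 cK; have split (r : R) :
    bex r E (fun w => (K (open_cluster w o) (w :&: touch E (open_cluster w o)))%:R) =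
    \sum_B bex r (touch E B) (fun w => ((open_cluster w o == B) && K B w)%:R).
  under [RHS]eq_bigr => B _ do rewrite -(bex_marginal r _ (touch_sub E B)).
  rewrite -bex_sum; apply: eq_bex => w wE.
  transitivity (\sum_B (open_cluster w o == B)%:R * (K B (w :&: touch E B))%:R : R).
    exact: (split_cluster w o (fun B => (K B (w :&: touch E B))%:R : R)).
  by apply: eq_bigr => B _; rewrite -open_cluster_touch // -natrM mulnb.
rewrite !split mulr_sumr; apply: ler_sum => B _; rewrite -bexZ.
apply: ler_sum => w wT; rewrite mulrCA mulrA.
have [/andP[/eqP wB Kw]|] := boolP (_ && _); last by rewrite !mulr0.
have TE : touch E B \subset E := touch_sub E B.
have := cK w (subset_trans wT TE); rewrite /= wB (setIidPl wT).
by rewrite !mulr1; apply.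
Qed.

End DomainMarkov.

(** * Paths and clusters *)

Section Paths.
Variable G : sgraph.
Implicit Types (w u E : {set {set G}}) (A B U : {set G}) (x y z a b o v : G).

(** Vertex sets provide the disjoint witnesses for BK: a path inside [U] uses only [inner w U], and
    a path that avoids [U] after its first vertex uses only the other edges. *)
Definition inner w U := [set e in w | e \subset U].

Lemma inner_sub w U : inner w U \subset w.
Proof. by apply/subsetP => e; rewrite inE => /andP[]. Qed.

Lemma path_inner w U x s : path (open_adj w) x s -> x \in U -> {subset s <= U} ->
  path (open_adj (inner w U)) x s.
Proof.
elim: s x => //= y s IH x /andP[/andP[xy xyw] sp] xU sU.
have yU : y \in U by apply: sU; rewrite inE eqxx.
rewrite /open_adj xy inE xyw subUset !sub1set xU yU /=.
by apply: IH => // z zs; apply: sU; rewrite inE zs orbT.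
Qed.

Lemma path_outer w U x s : path (open_adj w) x s -> {in s, forall y, y \notin U} ->
  path (open_adj (w :\: inner w U)) x s.
Proof.
elim: s x => //= y s IH x /andP[/andP[xy xyw] sp] sU.
have yU : y \notin U by apply: sU; rewrite inE eqxx.
rewrite /open_adj xy !inE xyw subUset !sub1set (negbTE yU) !andbF /=.
by apply: IH => // z zs; apply: sU; rewrite inE zs orbT.
Qed.

Lemma open_connectedS w w' x y : w \subset w' ->
  open_connected w x y -> open_connected w' x y.
Proof. by move=> /(open_clusterS x)/subsetP/(_ y); rewrite !inE. Qed.

Definition dconn w x a y :=
  [exists w1 : {set {set G}}, (w1 \subset w) &&
    (open_connected w1 x a && open_connected (w :\: w1) a y)].

Lemma dconnS w w' x a y : w \subset w' -> dconn w x a y -> dconn w' x a y.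
Proof.
move=> ww /existsP[w1 /and3P[w1w c1 c2]]; apply/existsP; exists w1.
rewrite (subset_trans w1w ww) c1 /=; apply: open_connectedS c2.
exact: setSD.
Qed.

Lemma dconn_path w x s a : path (open_adj w) x s -> uniq (x :: s) ->
  a \in x :: s -> dconn w x a (last x s).
Proof.
move=> sp us asx; case/splitPl: asx sp us => s1 s2 l1 sp us.
move: sp; rewrite cat_path => /andP[sp1 sp2].
pose U := [set z in x :: s1]; apply/existsP; exists (inner w U).
rewrite inner_sub /=; apply/andP; split.
  apply/connectP; exists s1; last by rewrite l1.
  apply: path_inner sp1 _ _; first by rewrite !inE eqxx.
  by move=> z zs; rewrite !inE zs orbT.
apply/connectP; exists s2; last by rewrite last_cat l1.
apply: path_outer; first by rewrite -l1.
move=> z zs; rewrite inE; move: us; rewrite -cat_cons cat_uniq => /and3P[_ /hasPn h _].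
exact: h.
Qed.

(** If a simple path from [v] to [y] avoided [B], it would survive the removal of the edges touching
    [B]. Cutting it at a vertex of [B] gives two disjoint pieces. *)
Lemma dconn_through E w v y B : w \subset E -> y \in open_cluster w v ->
  y \notin open_cluster (w :\: touch E B) v -> exists2 a, a \in B & dconn w v a y.
Proof.
move=> wE; rewrite !inE => /connectP[s0 /shortenP[s sp us _] ->] => nc.
have [/hasP[a asp aB]|/hasPn nB] := boolP (has [in B] (v :: s)).
  by exists a => //; apply: dconn_path.
case/negP: nc; apply/connectP; exists s => //.
elim: s v sp nB {us} => //= z s IH v /andP[/andP[vz vzw] sp] nB.
rewrite /open_adj vz !inE vzw andbT touches2 (negbTE (nB v _)) ?mem_head //=.
rewrite (negbTE (nB z _)) ?inE ?eqxx ?orbT // andbF /=.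
by apply: IH => // t ts; apply: nB; rewrite inE ts orbT.
Qed.

Lemma last_exit w o s U : o \in U -> path (open_adj w) o s ->
  exists z t, [/\ z \in U, path (open_adj w) z t, last z t = last o s &
    {in t, forall y, y \notin U}].
Proof.
move=> oU; elim/last_ind: s => [_|s x IH]; first by exists o, [::].
rewrite rcons_path => /andP[sp lx]; have [xU|xU] := boolP (x \in U).
  by exists x, [::]; rewrite last_rcons.
have [z [t [zU tp lt tU]]] := IH sp; exists z, (rcons t x); split => //.
- by rewrite rcons_path tp lt.
- by rewrite !last_rcons.
by move=> y; rewrite mem_rcons inE => /predU1P[->|/tU].
Qed.

(** The point [z] is the last vertex that the path to [x] shares with a simple path from [o] to [a].
    The simple path is cut at [z] and the rest of the other path avoids it, which gives three
    disjoint connections. *)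
Lemma branch_point w o a x : open_connected w o a -> open_connected w o x ->
  exists z, [exists w1 : {set {set G}}, (w1 \subset w) &&
    (dconn w1 o z a && open_connected (w :\: w1) z x)].
Proof.
move=> /connectP[s0 /shortenP[s sp us _] ->] /connectP[t0 tp0 ->].
pose U := [set z in o :: s].
have oU : o \in U by rewrite !inE eqxx.
have [z [t [zU tp <- tU]]] := last_exit oU tp0.
exists z; apply/existsP; exists (inner w U); rewrite inner_sub /=.
apply/andP; split; last by apply/connectP; exists t => //; apply: path_outer.
apply: dconn_path => //; last by move: zU; rewrite inE.
by apply: path_inner => // y ys; rewrite !inE ys orbT.
Qed.

Lemma open_cluster_eq w x y : y \in open_cluster w x -> open_cluster w y = open_cluster w x.
Proof.
rewrite inE => xy; apply/setP => z; rewrite !inE.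
by rewrite /open_connected (same_connect (open_connected_sym w) xy).
Qed.

Lemma open_cluster_sym w x y : (y \in open_cluster w x) = (x \in open_cluster w y).
Proof. by rewrite !inE; apply: open_connected_sym. Qed.

Lemma open_cluster_closed w x y z : y \in open_cluster w x -> open_adj w y z ->
  z \in open_cluster w x.
Proof. by rewrite -reach1; apply: reach_closed. Qed.

Lemma open_cluster_off E w a b : w \subset E -> b \notin open_cluster w a ->
  open_cluster (w :\: touch E (open_cluster w a)) b = open_cluster w b.
Proof.
move=> /subsetP wE ab; apply/eqP; rewrite eqEsubset open_clusterS ?subsetDl //=.
apply: open_cluster_min; first exact: open_cluster_refl.
move=> y z yr yz; have yb : y \in open_cluster w b.
  by apply: subsetP yr; apply: open_clusterS; apply: subsetDl.
apply: open_cluster_closed yr _.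
have nb t : t \in open_cluster w b -> t \notin open_cluster w a.
  by move=> /open_cluster_eq tb; rewrite open_cluster_sym tb open_cluster_sym.
have zb : z \in open_cluster w b by apply: open_cluster_closed yb yz.
by case/andP: yz => yz yzw; rewrite /open_adj yz 2!inE yzw touches2 (negbTE (nb _ yb)) (negbTE (nb _ zb)) andbF.
Qed.

Lemma open_clusterU1 w x a b : adj a b ->
  open_cluster ([set a; b] |: w) x =
  if (a \in open_cluster w x) || (b \in open_cluster w x)
  then open_cluster w a :|: open_cluster w b else open_cluster w x.
Proof.
move=> ab; have ba : adj b a by rewrite adj_sym.
have sw : w \subset [set a; b] |: w by apply: subsetUr.
have mono y : open_cluster w y \subset open_cluster ([set a; b] |: w) y.
  exact: open_clusterS.
have abC y z : [set y; z] = [set a; b] -> z \in [set a; b].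
  by move=> <-; rewrite !inE eqxx orbT.
have cab : b \in open_cluster ([set a; b] |: w) a.
  by apply: (open_cluster_closed (open_cluster_refl _ _)); rewrite /open_adj ab setU11.
case: ifP => [abx|/norP[ax bx]]; apply/eqP; rewrite eqEsubset.
  apply/andP; split.
    apply: open_cluster_min.
      by rewrite inE !(open_cluster_sym w _ x).
    move=> y z yU /andP[yz]; rewrite in_setU1 => /predU1P[/abC|yzw].
      by rewrite !inE => /orP[] /eqP ->; rewrite /open_connected connect0 ?orbT.
    move: yU; rewrite !in_setU => /orP[] yU; apply/orP; [left|right];
      by apply: open_cluster_closed yU _; rewrite /open_adj yz.
  have eab := open_cluster_eq cab.
  have -> : open_cluster ([set a; b] |: w) x = open_cluster ([set a; b] |: w) a.
    case/orP: abx => h; first exact/esym/open_cluster_eq/(subsetP (mono x)).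
    by rewrite -eab; apply/esym/open_cluster_eq/(subsetP (mono x)).
  by rewrite subUset mono -eab mono.
rewrite mono andbT; apply: open_cluster_min; first exact: open_cluster_refl.
move=> y z yx /andP[yz]; rewrite in_setU1 => /predU1P[E|yzw].
  have : y \in [set a; b] by rewrite -E !inE eqxx.
  by rewrite !inE => /orP[] /eqP yE; rewrite -yE yx in ax bx.
by apply: open_cluster_closed yx _; rewrite /open_adj yz.
Qed.

(** The sum over vertices is the sum of the squared cluster sizes, and merging clusters of sizes s
    and t adds (s + t)^2 - s^2 - t^2. *)
Lemma sum_open_clusterU1 (R : realFieldType) w a b : adj a b ->
  \sum_x #|open_cluster ([set a; b] |: w) x|%:R - \sum_x #|open_cluster w x|%:R =
  2 * ((b \notin open_cluster w a)%:R *
       (#|open_cluster w a|%:R * #|open_cluster w b|%:R)) :> R.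
Proof.
move=> ab; rewrite -sumrB.
have [ba|ba] /= := boolP (b \in open_cluster w a).
  rewrite mul0r mulr0 big1 // => x _; rewrite open_clusterU1 //.
  case: ifP => [abx|]; last by rewrite subrr.
  rewrite (open_cluster_eq ba) setUid -(open_cluster_eq (x := a) (y := x)) ?subrr //.
  case/orP: abx => abx; first by rewrite open_cluster_sym.
  by rewrite -(open_cluster_eq ba) open_cluster_sym.
have dab : [disjoint open_cluster w a & open_cluster w b].
  rewrite -setI_eq0; apply/eqP/setP => z; rewrite in_setI in_set0; apply/negP => /andP[za zb].
  by case/negP: ba; rewrite -(open_cluster_eq za) open_cluster_sym.
have -> : 2 * (1 * (#|open_cluster w a|%:R * #|open_cluster w b|%:R)) =
   \sum_(x in open_cluster w a) #|open_cluster w b|%:R +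
   \sum_(x in open_cluster w b) #|open_cluster w a|%:R :> R.
  by rewrite !sumr_const mul1r mulrDl mul1r {1}mulr_natl mulr_natr.
rewrite (big_mkcond [in open_cluster w a]) (big_mkcond [in open_cluster w b]).
rewrite -big_split; apply: eq_bigr => x _ /=; rewrite open_clusterU1 //.
rewrite ![_ \in open_cluster w x]open_cluster_sym.
have [xa|xa] /= := boolP (x \in open_cluster w a).
  rewrite (disjointFr dab xa) addr0 (open_cluster_eq xa) cardsU.
  by move: dab; rewrite -setI_eq0 => /eqP ->; rewrite cards0 subn0 natrD addrC addKr.
have [xb|xb] := boolP (x \in open_cluster w b); last by rewrite subrr addr0.
rewrite (open_cluster_eq xb) cardsU.
by move: dab; rewrite -setI_eq0 => /eqP ->; rewrite cards0 subn0 natrD addrK add0r.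
Qed.

Lemma sum_edges (R : realFieldType) (f : {set G} -> R) (F : G -> G -> R) :
  (forall a b, adj a b -> f [set a; b] = F a b + F b a) ->
  \sum_(e in edges G) f e = \sum_a \sum_(b | adj a b) F a b.
Proof.
move=> fF; rewrite pair_big_dep /=.
have -> : \sum_(z : G * G | adj z.1 z.2) F z.1 z.2 =
  \sum_(z in [set z : G * G | adj z.1 z.2]) F z.1 z.2.
  by apply: eq_bigl => z; rewrite inE.
rewrite (partition_big_imset (fun z : G * G => [set z.1; z.2])) /=.
apply: eq_bigr => e /edgesP[a [b [ab ->]]]; rewrite fF //.
have ne : a != b by apply: contraTneq ab => ->; rewrite adj_irrefl.
have nab : (a, b) != (b, a) by rewrite xpair_eqE negb_and ne.
rewrite (bigD1 (a, b)) /=; last by rewrite inE ab eqxx.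
rewrite (bigD1 (b, a)) /=; last by rewrite inE /= adj_sym ab setUC eqxx eq_sym.
rewrite big1 ?addr0 // => -[x y] /=; rewrite inE /= !xpair_eqE.
case/andP=> /andP[/andP[xy /eqP E] n1] n2.
have xab : x \in [set a; b] by rewrite -E !inE eqxx.
have yab : y \in [set a; b] by rewrite -E !inE eqxx orbT.
have xny : x != y by apply: contraTneq xy => ->; rewrite adj_irrefl.
move: xab yab n1 n2 xny; rewrite !inE => /orP[] /eqP -> /orP[] /eqP ->; rewrite ?eqxx //=.
Qed.

Lemma card_touch m E B : regular_of_degree G m -> E \subset edges G ->
  (#|touch E B| <= m * #|B|)%N.
Proof.
move=> reg /subsetP EG.
have sub : touch E B \subset \bigcup_(x in B) [set [set x; y] | y in [set y | adj x y]].
  apply/subsetP => e; rewrite inE => /andP[/EG/edgesP[a [b [ab ->]]]].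
  rewrite touches2 => /orP[] h; apply/bigcupP.
    by exists a => //; apply: imset_f; rewrite inE.
  by exists b => //; rewrite setUC; apply: imset_f; rewrite inE adj_sym.
apply: leq_trans (subset_leq_card sub) _.
have le_bigcup (F : G -> {set {set G}}) : (#|\bigcup_(x in B) F x| <= \sum_(x in B) #|F x|)%N.
  elim/big_rec2: _ => [|x n U _ leU]; first by rewrite cards0.
  by rewrite cardsU; apply: leq_trans (leq_subr _ _) _; rewrite leq_add2l.
apply: leq_trans (le_bigcup _) _.
rewrite mulnC -sum_nat_const; apply: leq_sum => x _.
by rewrite -(reg x) leq_imset_card.
Qed.

End Paths.

(** * Correlation inequalities for clusters *)

Section Invariance.
Variables (R : realFieldType) (T : finType) (f : T -> T) (S : {set T}).
Hypotheses (injf : injective f) (fS : f @: S = S).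
Implicit Types (p : R) (X : {set T} -> R).

Lemma bex_imset p X : bex p S X = bex p S (fun w => X (f @: w)).
Proof.
rewrite /bex (reindex_inj (imset_inj injf)); apply: eq_big => [w|w _].
  apply/idP/idP => [|wS]; last by rewrite -fS imsetS.
  move=> /subsetP wS; apply/subsetP => x xw; have : f x \in S by apply/wS/imset_f.
  by rewrite -{1}fS mem_imset.
have -> : S :\: f @: w = f @: (S :\: w).
  apply/setP => x; apply/idP/imsetP => [|[y]].
    rewrite in_setD => /andP[xw]; rewrite -{1}fS => /imsetP[y yS xy]; exists y => //.
    by rewrite inE yS andbT; apply: contra xw => yw; rewrite xy imset_f.
  by rewrite in_setD => /andP[yw yS] ->; rewrite in_setD mem_imset // yw -{1}fS imset_f.
by rewrite !card_imset.
Qed.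

Lemma russo_imset p X : russo p S X = russo p S (fun w => X (f @: w)).
Proof.
rewrite /russo -{1}fS big_imset /=; last by move=> x y _ _; apply: injf.
apply: eq_bigr => e _; rewrite bex_imset; apply: eq_bex => w _.
rewrite /incr imsetU1; congr (_ - X _).
apply/setP => x; apply/setD1P/imsetP => [[xe /imsetP[y yw xy]]|[y]].
  by exists y => //; rewrite !inE yw andbT; apply: contraNneq xe => <-; rewrite xy.
by rewrite !inE => /andP[ye yw] ->; rewrite imset_f ?(inj_eq injf).
Qed.

End Invariance.

Section ClusterMoments.
Variables (R : realFieldType) (G : sgraph).
Implicit Types (p q : R) (w : {set {set G}}) (x y z a b o : G).
Local Notation E := (edges G).

Definition mean p o (h : nat -> R) : R :=
  bex p E (fun w => h #|open_cluster w o|).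

Definition dmean p o (h : nat -> R) : R :=
  russo p E (fun w => h #|open_cluster w o|).

Lemma open_cluster_aut (f : {perm G}) w x :
  (forall u v, adj (f u) (f v) = adj u v) ->
  #|open_cluster ((fun e : {set G} => f @: e) @: w) (f x)| = #|open_cluster w x|.
Proof.
move=> autf; have pinj : injective f by apply: perm_inj.
have injf : injective (fun e : {set G} => f @: e) by apply: imset_inj.
set fw := _ @: w.
have adjE u v : open_adj fw (f u) (f v) = open_adj w u v.
  rewrite /open_adj autf; congr andb.
  have -> : [set f u; f v] = f @: [set u; v] by rewrite imsetU1 imset_set1.
  by rewrite /fw (mem_imset w [set u; v] injf).
have -> : open_cluster fw (f x) = f @: open_cluster w x.
  apply/eqP; rewrite eqEsubset; apply/andP; split.
    apply: open_cluster_min; first by rewrite imset_f // open_cluster_refl.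
    move=> y z /imsetP[u ux ->]; have -> : z = f ((f^-1)%g z) by rewrite permKV.
    by rewrite adjE => uz; apply: imset_f; apply: open_cluster_closed ux uz.
  apply/subsetP => _ /imsetP[y yx ->].
  have : open_cluster w x \subset f @^-1: open_cluster fw (f x).
    apply: open_cluster_min; first by rewrite inE open_cluster_refl.
    by move=> u v; rewrite !inE -!(in_set (open_connected _ _)) => ux; rewrite -adjE; apply: open_cluster_closed.
  by move=> /subsetP/(_ y yx); rewrite inE.
by rewrite card_imset.
Qed.

Lemma edges_aut (f : {perm G}) :
  (forall u v, adj (f u) (f v) = adj u v) -> (fun e : {set G} => f @: e) @: E = E.
Proof.
move=> autf; apply/setP => e; apply/imsetP/edgesP => [[_ /edgesP[a [b [ab ->]]] ->]|].
  by exists (f a), (f b); rewrite autf imsetU1 imset_set1.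
move=> [a [b [ab ->]]]; exists [set (f^-1)%g a; (f^-1)%g b].
  by apply/edgesP; exists ((f^-1)%g a), ((f^-1)%g b); rewrite -autf !permKV.
by rewrite imsetU1 imset_set1 !permKV.
Qed.

Section Transitive.
Hypothesis trG : vertex_transitive G.

Lemma mean_transitive p x y h : mean p x h = mean p y h.
Proof.
have [f [autf <-]] := trG x y.
have injf : injective (fun e : {set G} => f @: e) by apply: imset_inj; apply: perm_inj.
rewrite /mean [RHS](bex_imset injf (edges_aut autf)).
by apply: eq_bex => w _; rewrite open_cluster_aut.
Qed.

Lemma dmean_transitive p x y h : dmean p x h = dmean p y h.
Proof.
have [f [autf <-]] := trG x y.
have injf : injective (fun e : {set G} => f @: e) by apply: imset_inj; apply: perm_inj.
rewrite /dmean [RHS](russo_imset injf (edges_aut autf)).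
apply: eq_bigr => e _; apply: eq_bex => w _.
by rewrite /incr !open_cluster_aut.
Qed.

End Transitive.

Definition tau p x y : R := bex p E (fun w => (open_connected w x y)%:R).

Lemma tau_sym p x y : tau p x y = tau p y x.
Proof. by apply: eq_bex => w _; congr (nat_of_bool _)%:R; apply: open_connected_sym. Qed.

Lemma tau_refl p x : tau p x x = 1.
Proof.
rewrite -[RHS](bex_cst p E); apply: eq_bex => w _.
by rewrite /open_connected connect0.
Qed.

Lemma sum_open_connected w x : \sum_y (open_connected w x y)%:R = #|open_cluster w x|%:R :> R.
Proof.
rewrite -sum1_card natr_sum [RHS]big_mkcond; apply: eq_bigr => y _.
by rewrite inE; case: open_connected.
Qed.

Lemma sum_tau p x : \sum_y tau p x y = mean p x (fun n => n%:R).
Proof. by rewrite -bex_sum; apply: eq_bex => w _; apply: sum_open_connected. Qed.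

Section Bounds.
Variable p : R.
Hypothesis p01 : 0 <= p <= 1.

Lemma tau_ge0 x y : 0 <= tau p x y.
Proof. by apply: bex_ge0. Qed.

Lemma bex_dconn x a y : bex p E (fun w => (dconn w x a y)%:R) <= tau p x a * tau p a y.
Proof.
apply: le_trans (bk E (Q := fun u v => open_connected u x a && open_connected v a y) p01 _) _.
  move=> u u' v v' uu vv /andP[c1 c2].
  by rewrite (open_connectedS uu c1) (open_connectedS vv c2).
rewrite /tau -bexZr le_eqVlt; apply/orP; left; apply/eqP; apply: eq_bex => w _.
by rewrite -bexZ; apply: eq_bex => w' _; rewrite -natrM mulnb.
Qed.

(** The tree-graph inequality: a union bound over branch points, then BK twice. *)
Lemma three_point o a x :
  bex p E (fun w => (open_connected w o a && open_connected w o x)%:R) <=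
  \sum_z tau p o z * tau p z a * tau p z x.
Proof.
pose br w z := [exists w1 : {set {set G}}, (w1 \subset w) &&
    (dconn w1 o z a && open_connected (w :\: w1) z x)].
apply: le_trans (_ : bex p E (fun w => \sum_z (br w z)%:R) <= _).
  apply: le_bex => // w _; have [/andP[oa ox]|] := boolP (_ && _); last by rewrite sumr_ge0.
  have [z bz] := branch_point oa ox; rewrite (bigD1 z) //= /br bz.
  by rewrite lerDl sumr_ge0.
rewrite bex_sum; apply: ler_sum => z _.
apply: le_trans (bk E (Q := fun u v => dconn u o z a && open_connected v z x) p01 _) _.
  move=> u u' v v' uu vv /andP[c1 c2].
  by rewrite (dconnS uu c1) (open_connectedS vv c2).
apply: le_trans (_ : bex p E (fun w => (dconn w o z a)%:R) * tau p z x <= _); last first.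
  by rewrite ler_wpM2r ?tau_ge0 // bex_dconn.
rewrite /tau -bexZr le_eqVlt; apply/orP; left; apply/eqP; apply: eq_bex => w _.
by rewrite -bexZ; apply: eq_bex => w' _; rewrite -natrM mulnb.
Qed.

End Bounds.

(** Given the cluster of [a], a different cluster of [b] lives on fresh edges that avoid it.
    Deleting edges only shrinks the cluster of [b], hence the upper bound [cluster_pair_le]; the
    loss is estimated in [cluster_pair_ge]. *)
Lemma cluster_pair p (F : {set {set G}}) a b (Psi : {set G} -> {set G} -> R) :
  bex p F (fun w => (b \notin open_cluster w a)%:R * Psi (open_cluster w a) (open_cluster w b)) =
  bex p F (fun w => bex p F (fun w' => (b \notin open_cluster w a)%:R *
     Psi (open_cluster w a) (open_cluster (w' :\: touch F (open_cluster w a)) b))).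
Proof.
rewrite -(domain_markov p F a (fun B u => (b \notin B)%:R * Psi B (open_cluster u b))).
apply: eq_bex => w wF; have [ba|] := boolP (b \in open_cluster w a); first by rewrite !mul0r.
by move=> ba; rewrite open_cluster_off.
Qed.

Lemma cluster_pair_le p (F : {set {set G}}) a b (h1 h2 : nat -> R) : 0 <= p <= 1 ->
  (forall n, 0 <= h1 n) -> (forall n, 0 <= h2 n) -> {homo h2 : m n / (m <= n)%N >-> m <= n} ->
  bex p F (fun w => (b \notin open_cluster w a)%:R *
    (h1 #|open_cluster w a| * h2 #|open_cluster w b|)) <=
  bex p F (fun w => h1 #|open_cluster w a|) * bex p F (fun w => h2 #|open_cluster w b|).
Proof.
move=> p01 h10 h20 mh2.
rewrite (cluster_pair p F a b (fun A B => h1 #|A| * h2 #|B|)) -bexZr.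
apply: le_bex => // w _; rewrite -bexZ; apply: le_bex => // w' _.
rewrite -[leRHS]mul1r; apply: ler_pM => //; rewrite ?mulr_ge0 //.
  by rewrite lern1 leq_b1.
by rewrite ler_wpM2l // mh2 // subset_leq_card // open_clusterS // subsetDl.
Qed.

Definition nabla p a b := \sum_u \sum_v tau p a u * tau p u v * tau p v b.

(** A vertex lost by deleting the edges at C(a) was reached from [b] through some z in C(a), so by
    BK the mean loss is at most chi times the sum of tau b z over z in C(a). Weighting by |C(a)| and
    applying [three_point] closes this into the triangle diagram [nabla]. *)
Lemma cluster_pair_ge p chi a b : 0 <= p <= 1 ->
  (forall x, mean p x (fun n => n%:R) = chi) ->
  chi ^+ 2 * (1 - nabla p a b) <=
  bex p E (fun w => (b \notin open_cluster w a)%:R *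
    (#|open_cluster w a|%:R * #|open_cluster w b|%:R)).
Proof.
move=> p01 chiE; have chi0 : 0 <= chi by rewrite -(chiE a); apply: bex_ge0.
rewrite (cluster_pair p E a b (fun A B => #|A|%:R * #|B|%:R)).
have off (B : {set G}) : chi * (1 - \sum_(z in B) tau p b z) <=
    bex p E (fun w => #|open_cluster (w :\: touch E B) b|%:R).
  rewrite mulrBr mulr1 -{1}(chiE b) lerBlDr /mean.
  apply: le_trans (_ : _ <= bex p E (fun w => #|open_cluster (w :\: touch E B) b|%:R) +
     bex p E (fun w => \sum_(z in B) \sum_y (dconn w b z y)%:R)) _.
    rewrite -bexD; apply: le_bex => // w wE.
    rewrite -!sum_open_connected exchange_big -big_split /=; apply: ler_sum => y _.
    have [by_|_] := boolP (open_connected w b y); last by rewrite addr_ge0 ?sumr_ge0.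
    have [_|nby] := boolP (open_connected (_ :\: _) b y).
      by rewrite lerDl sumr_ge0.
    have [||z zB dz] := @dconn_through _ E w b y B wE; rewrite ?inE //.
    by rewrite add0r (bigD1 z) //= dz lerDl sumr_ge0.
  rewrite lerD2l bex_sum mulr_sumr; apply: ler_sum => z zB.
  rewrite bex_sum -(chiE z) -sum_tau mulr_suml; apply: ler_sum => y _.
  by apply: le_trans (bex_dconn p01 _ _ _) _; rewrite mulrC.
apply: le_trans (_ : _ <= bex p E (fun w => #|open_cluster w a|%:R *
    (chi * (1 - \sum_(z in open_cluster w a) tau p b z)))) _; last first.
  apply: le_bex => // w _; have [ba|ba] := boolP (b \in open_cluster w a).
    apply: le_trans (_ : _ <= 0) _; last by apply: bex_ge0 => // w' _; rewrite mul0r.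
    rewrite mulr_ge0_le0 // mulr_ge0_le0 // subr_le0 (bigD1 b) //= tau_refl.
    by rewrite lerDl sumr_ge0 // => z _; apply: tau_ge0.
  apply: le_trans (ler_wpM2l (ler0n _ _) (off (open_cluster w a))) _.
  by rewrite -bexZ le_eqVlt; apply/orP; left; apply/eqP/eq_bex => w' _; rewrite mul1r.
have -> : bex p E (fun w => #|open_cluster w a|%:R *
    (chi * (1 - \sum_(z in open_cluster w a) tau p b z))) =
  chi * (chi - bex p E (fun w => #|open_cluster w a|%:R * \sum_(z in open_cluster w a) tau p b z)).
  by rewrite -{3}(chiE a) /mean -bexB -bexZ; apply: eq_bex => w _; ring.
rewrite expr2 -mulrA ler_wpM2l // mulrBr mulr1 lerD2l lerN2.
have -> : bex p E (fun w => #|open_cluster w a|%:R * \sum_(z in open_cluster w a) tau p b z) =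
  \sum_x \sum_z bex p E (fun w => (open_connected w a z && open_connected w a x)%:R) * tau p b z.
  under eq_bigr => x _ do under eq_bigr => z _ do rewrite -bexZr.
  under eq_bigr => x _ do rewrite -bex_sum.
  rewrite -bex_sum; apply: eq_bex => w _; rewrite -sum_open_connected mulr_suml.
  apply: eq_bigr => x _; rewrite big_mkcond mulr_sumr; apply: eq_bigr => z _.
  by rewrite inE; do 2 case: open_connected; rewrite ?(mulr0, mul0r, mul1r).
apply: le_trans (_ : \sum_x \sum_z (\sum_y tau p a y * tau p y z * tau p y x) * tau p b z <= _).
  apply: ler_sum => x _; apply: ler_sum => z _.
  by rewrite ler_wpM2r ?tau_ge0 // three_point.
apply: eq_ler.
under eq_bigr => x _ do under eq_bigr => z _ do rewrite mulr_suml.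
under eq_bigr => x _ do rewrite exchange_big /=.
rewrite exchange_big mulr_sumr; apply: eq_bigr => y _.
rewrite exchange_big mulr_sumr; apply: eq_bigr => z _ /=.
rewrite -(chiE y) -sum_tau [RHS]mulr_suml; apply: eq_bigr => x _.
by rewrite (tau_sym p b); ring.
Qed.

End ClusterMoments.

Lemma bex_cauchy_schwarz (R : realFieldType) (T : finType) (p : R) (S : {set T}) (X Y : {set T} -> R) : 0 <= p <= 1 ->
  bex p S (fun w => X w * Y w) ^+ 2 <=
  bex p S (fun w => X w ^+ 2) * bex p S (fun w => Y w ^+ 2).
Proof.
move=> p01; set b := bex p S (fun w => X w * Y w).
set u := bex p S (fun w => X w ^+ 2); set v := bex p S (fun w => Y w ^+ 2).
have q s t : 0 <= s ^+ 2 * u - 2 * s * t * b + t ^+ 2 * v.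
  have -> : s ^+ 2 * u - 2 * s * t * b + t ^+ 2 * v =
      bex p S (fun w => (s * X w - t * Y w) ^+ 2).
    rewrite -!bexZ -bexB -bexD; apply: eq_bex => w _; ring.
  by apply: bex_ge0 => // w _; apply: sqr_ge0.
have v0 : 0 <= v by apply: bex_ge0 => // w _; apply: sqr_ge0.
have [v0'|v0'] := ltP 0 v.
  have := q v b; have -> : v ^+ 2 * u - 2 * v * b * b + b ^+ 2 * v = v * (u * v - b ^+ 2) by ring.
  by rewrite pmulr_rge0 // subr_ge0.
have {v0 v0'} vE : v = 0 by apply/eqP; rewrite eq_le v0 v0'.
(* For v = 0 the quadratic form is s^2 u - 2 s t b; this choice of s and t gives - b^2. *)
have := q b ((u + 1) / 2); rewrite vE !mulr0 addr0.
have -> : b ^+ 2 * u - 2 * b * ((u + 1) / 2) * b = - b ^+ 2 by field.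
by rewrite oppr_ge0.
Qed.

(** * Derivative of the susceptibility, OSSS and variance on a transitive graph *)

Section TransitiveGraph.
Variables (R : realFieldType) (G : sgraph) (m : nat) (o : G) (p : R).
Hypotheses (trG : vertex_transitive G) (regG : regular_of_degree G m).
Hypothesis p01 : 0 <= p <= 1.
Local Notation E := (edges G).
Local Notation chi := (mean p o (fun n => n%:R)).
Local Notation dchi := (dmean p o (fun n => n%:R)).

Lemma sum_vertices (c : R) : \sum_(x : G) c = #|G|%:R * c.
Proof. by rewrite sumr_const [RHS]mulr_natl; congr (c *+ _); apply: eq_card. Qed.

Lemma mean_ge0 h : (forall n, 0 <= h n) -> 0 <= mean p o h.
Proof. by move=> h0; apply: bex_ge0. Qed.

Lemma le_mean h1 h2 : (forall n, h1 n <= h2 n) -> mean p o h1 <= mean p o h2.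
Proof. by move=> h0; apply: le_bex. Qed.

Lemma chi_ge1 : 1 <= chi.
Proof.
rewrite -[leLHS](bex_cst p E); apply: le_bex => // w _; rewrite ler1n.
by apply/card_gt0P; exists o; apply: open_cluster_refl.
Qed.

Lemma chi_gt0 : 0 < chi. Proof. exact: lt_le_trans chi_ge1. Qed.

Lemma card_vertex_gt0 : 0 < #|G|%:R :> R.
Proof. by rewrite ltr0n; apply/card_gt0P; exists o. Qed.

(** Summing over the starting vertex makes the increment of Russo's formula an explicit product of
    two cluster sizes; its factor 2 is shared by the two orientations of the edge. *)
Lemma sum_dmean :
  \sum_(x : G) dmean p x (fun n => n%:R) = \sum_(a : G) \sum_(b | adj a b)
    bex p (E :\ [set a; b]) (fun w => (b \notin open_cluster w a)%:R *
       (#|open_cluster w a|%:R * #|open_cluster w b|%:R)).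
Proof.
rewrite exchange_big /=.
have -> : \sum_(e in E) \sum_(x : G) bex p E (incr e (fun w => #|open_cluster w x|%:R)) =
    \sum_(e in E) bex p (E :\ e) (fun w =>
      \sum_x #|open_cluster (e |: w) x|%:R - \sum_x #|open_cluster w x|%:R).
  apply: eq_bigr => e eE; rewrite -bex_sum -bex_incr //; apply: eq_bex => w _.
  by rewrite /incr -sumrB.
apply: sum_edges => a b ab; rewrite [[set b; a]]setUC -bexD; apply: eq_bex => w _.
rewrite sum_open_clusterU1 // mulrDl mul1r; congr (_ + _).
by rewrite open_cluster_sym [X in _ * X]mulrC.
Qed.

Lemma sum_adj (c : R) : \sum_(a : G) \sum_(b | adj a b) c = #|G|%:R * (m%:R * c).
Proof.
under eq_bigr => a _.
  have -> : \sum_(b | adj a b) c = m%:R * c.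
    rewrite sumr_const -(regG a) mulr_natl; congr (_ *+ _).
    by apply: eq_card => b; rewrite inE.
  over.
by rewrite sum_vertices.
Qed.

Lemma dmean_card : #|G|%:R * dchi = \sum_(x : G) dmean p x (fun n => n%:R).
Proof.
rewrite (eq_bigr (fun=> dchi)) => [|x _]; last exact: dmean_transitive.
by rewrite sum_vertices.
Qed.

Lemma dchi_le : dchi <= m%:R * chi ^+ 2.
Proof.
rewrite -(ler_pM2l card_vertex_gt0) dmean_card sum_dmean -sum_adj.
apply: ler_sum => a _; apply: ler_sum => b _.
have sub x : bex p (E :\ [set a; b]) (fun w => #|open_cluster w x|%:R) <= chi.
  rewrite (mean_transitive trG p o x); apply: bex_subset => //; first exact: subsetDl.
  by move=> w w' ww; rewrite ler_nat subset_leq_card // open_clusterS.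
apply: le_trans (cluster_pair_le (h1 := fun n => n%:R) (h2 := fun n => n%:R) _ _ _ p01 _ _ _) _ => //.
  by move=> i j; rewrite ler_nat.
by rewrite expr2; apply: ler_pM => //; apply: bex_ge0.
Qed.

Lemma dchi_ge s : (forall a b : G, adj a b -> nabla p a b <= s) ->
  m%:R * (chi ^+ 2 * (1 - s)) <= dchi.
Proof.
move=> nab; rewrite -(ler_pM2l card_vertex_gt0) dmean_card sum_dmean -sum_adj.
apply: ler_sum => a _; apply: ler_sum => b ab.
apply: le_trans (_ : chi ^+ 2 * (1 - nabla p a b) <= _).
  by rewrite ler_wpM2l ?sqr_ge0 // lerD2l lerN2 nab.
apply: le_trans (cluster_pair_ge _ _ p01 _) _ => [x|]; first exact: mean_transitive.
have abE : [set a; b] \in E by apply/edgesP; exists a, b.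
(* [cluster_pair_ge] averages over all edges. Its integrand vanishes when the edge ab is open, so it
   equals 1 - p times the average without that edge. *)
rewrite (bexD1 p _ abE).
set F := fun w : {set {set G}} => _.
have -> : bex p (E :\ [set a; b]) (fun w => F ([set a; b] |: w)) = 0.
  rewrite -(bex_cst p (E :\ [set a; b]) 0); apply: eq_bex => w _; rewrite /F.
  suff -> : b \in open_cluster ([set a; b] |: w) a by rewrite mul0r.
  by apply: (open_cluster_closed (open_cluster_refl _ _)); rewrite /open_adj ab setU11.
rewrite mulr0 add0r ler_piMl //; first by apply: bex_ge0 => // w _; rewrite mulr_ge0 ?mulr_ge0.
by case/andP: p01 => p0 _; rewrite lerBlDr lerDl.
Qed.

(** OSSS is summed over the starting vertex [u], with [phi] the event that [o] is reached. An edge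
    is revealed from [u] only if [u] lies in the cluster of one of its endpoints, so its revealment
    probabilities sum to at most 2 chi. *)
Lemma osss_mean h : {homo h : i j / (i <= j)%N >-> i <= j} ->
  mean p o (fun n => n%:R * h n) <=
  chi * mean p o h + 2 * chi * (p * (1 - p) * dmean p o h).
Proof.
move=> mh; pose g w := h #|open_cluster w o|.
have mg (w w' : {set {set G}}) : w \subset w' -> g w <= g w'.
  by move=> ww; apply: mh; rewrite subset_leq_card // open_clusterS.
pose phi (B : {set G}) : R := (o \in B)%:R.
have phi01 B : 0 <= phi B <= 1 by rewrite ler0n lern1 leq_b1.
have -> : mean p o (fun n => n%:R * h n) =
    \sum_u bex p E (fun w => phi (reach w [set u]) * g w).
  rewrite -bex_sum; apply: eq_bex => w _; rewrite -mulr_suml; congr (_ * _).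
  rewrite -sum_open_connected; apply: eq_bigr => u _; rewrite /phi reach1.
  by rewrite -open_cluster_sym inE.
apply: le_trans (ler_sum _ (fun u _ => osss p01 [set u] (subxx E) phi01 mg)) _.
rewrite big_split /=; apply: lerD.
  rewrite -mulr_suml le_eqVlt; apply/orP; left; apply/eqP; congr (_ * _).
  rewrite -bex_sum; apply: eq_bex => w _.
  rewrite -sum_open_connected; apply: eq_bigr => u _; rewrite /phi reach1.
  by rewrite -open_cluster_sym inE.
have q0 : 0 <= p * (1 - p) by case/andP: p01 => p0 p1; rewrite mulr_ge0 ?subr_ge0.
rewrite -mulr_sumr mulrCA ler_wpM2l // exchange_big mulr_sumr; apply: ler_sum => e eE.
rewrite -mulr_suml; apply: ler_wpM2r.
  apply: bex_ge0 => // w _; rewrite subr_ge0; apply: mg.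
  exact: subset_trans (subsetDl _ _) (subsetUr _ _).
have /edgesP[a [b [ab ->]]] := eE.
rewrite mulrDl mul1r {1}(mean_transitive trG p o a) (mean_transitive trG p o b) -!sum_tau -big_split.
apply: ler_sum => u _; rewrite /= -bexD; apply: le_bex => // w _.
rewrite touches2 reach1 ![_ \in open_cluster w u]open_cluster_sym !inE.
by case: (open_connected w a u); case: (open_connected w b u); rewrite -natrD ler_nat.
Qed.

Definition cluster_score w := score p E (open_cluster w o) w.

Lemma cluster_score_sqr :
  bex p E (fun w => cluster_score w ^+ 2) <= p * (1 - p) * (m%:R * chi).
Proof.
have q0 : 0 <= p * (1 - p) by case/andP: p01 => p0 p1; rewrite mulr_ge0 ?subr_ge0.
have := bex_score_sqr p [set o] (subxx E).
under eq_bex => w _ do rewrite reach1.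
move=> ->; rewrite ler_wpM2l // -bexZ; apply: le_bex => // w _.
by rewrite reach1 -natrM ler_nat card_touch.
Qed.

Lemma dchi_sqr_le :
  (p * (1 - p) * dchi) ^+ 2 <= mean p o (fun n => n%:R ^+ 2) * (p * (1 - p) * (m%:R * chi)).
Proof.
rewrite /dmean -russo_score.
have -> : bex p E (fun w => #|open_cluster w o|%:R * \sum_(e in E) ((e \in w)%:R - p)) =
   bex p E (fun w => #|open_cluster w o|%:R * cluster_score w).
  have := @bex_phi_score _ _ p E [set o] (fun B => #|B|%:R) (subxx E).
  under eq_bex => w _ do rewrite reach1.
  by move=> ->; apply: eq_bex => w _; rewrite reach1.
apply: le_trans (bex_cauchy_schwarz _ _ _ p01) _.
by rewrite ler_wpM2l ?cluster_score_sqr //; apply: bex_ge0 => // w _; apply: sqr_ge0.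
Qed.

(** Pairs in different clusters contribute at most the square of the mean, by [cluster_pair_le];
    pairs in the same cluster contribute at most |C| h(|C|) per vertex. *)
Lemma count_variance (h : nat -> R) : (forall n, 0 <= h n <= 1) ->
  {homo h : i j / (i <= j)%N >-> i <= j} ->
  bex p E (fun w => (\sum_(x : G) h #|open_cluster w x| - #|G|%:R * mean p o h) ^+ 2)
  <= #|G|%:R * mean p o (fun n => n%:R * h n).
Proof.
move=> h01 mh; set M := #|G|%:R * mean p o h.
have h0 n : 0 <= h n by case/andP: (h01 n).
have exN : bex p E (fun w => \sum_(x : G) h #|open_cluster w x|) = M.
  rewrite bex_sum (eq_bigr (fun=> mean p o h)) => [|x _]; last exact: mean_transitive.
  by rewrite sum_vertices.
have exN2 : bex p E (fun w => (\sum_(x : G) h #|open_cluster w x|) ^+ 2) <=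
    #|G|%:R * mean p o (fun n => n%:R * h n) + M ^+ 2.
  apply: le_trans (_ : _ <= \sum_(x : G) (mean p x (fun n => n%:R * h n) +
     \sum_(y : G) mean p x h * mean p y h)) _; last first.
    rewrite big_split /= (eq_bigr (fun=> mean p o (fun n => n%:R * h n))); last first.
      by move=> x _; apply: mean_transitive.
    rewrite sum_vertices lerD2l.
    rewrite (eq_bigr (fun=> \sum_(y : G) mean p o h * mean p o h)) => [|x _]; last first.
      by apply: eq_bigr => y _; congr (_ * _); apply: mean_transitive.
    by rewrite !sum_vertices le_eqVlt /M; apply/orP; left; apply/eqP; ring.
  apply: le_trans (_ : _ <= \sum_(x : G) (bex p E (fun w => #|open_cluster w x|%:R * h #|open_cluster w x|)
    + \sum_(y : G) bex p E (fun w => (y \notin open_cluster w x)%:R *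
    (h #|open_cluster w x| * h #|open_cluster w y|)))) _; last first.
    apply: ler_sum => x _; rewrite lerD2l; apply: ler_sum => y _.
    exact: cluster_pair_le.
  under eq_bigr => x _ do rewrite -bex_sum -bexD.
  rewrite -bex_sum; apply: le_bex => // w _.
  rewrite expr2 mulr_suml; apply: ler_sum => x _.
  rewrite -sum_open_connected mulr_suml mulr_sumr -big_split; apply: ler_sum => y _ /=.
  rewrite inE; have [xy|xy] := boolP (open_connected w x y); last by rewrite mul0r add0r mul1r.
  by rewrite mul0r addr0 mul1r; case/andP: (h01 #|open_cluster w y|) => _ h1; apply: ler_piMr.
have -> : bex p E (fun w => (\sum_(x : G) h #|open_cluster w x| - M) ^+ 2) =
  bex p E (fun w => (\sum_(x : G) h #|open_cluster w x|) ^+ 2)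
  - 2 * M * bex p E (fun w => \sum_(x : G) h #|open_cluster w x|) + M ^+ 2.
  rewrite -[in RHS](bex_cst p E (M ^+ 2)) -bexZ -bexB -bexD; apply: eq_bex => w _; ring.
rewrite exN; lra.
Qed.

End TransitiveGraph.

From mathcomp Require Import all_classical all_reals all_analysis.

Import numFieldNormedType.Exports.

Local Open Scope classical_set_scope.

(** * Differential inequalities *)

Section DifferentialInequalities.
Variables (R : realType) (f df : R -> R) (a b : R).
Hypotheses (ab : a <= b)
  (fdf : forall x, a <= x <= b -> is_derive x 1 f (df x)).

Lemma is_derive_ge_le (c : R) : (forall x, a <= x <= b -> c <= df x) ->
  c * (b - a) <= f b - f a.
Proof.
move=> cdf; have [x||x] := @MVT_segment R f df a b ab.
- by rewrite in_itv /= => /andP[ax xb]; apply: fdf; rewrite !ltW.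
- apply: derivable_within_continuous => x; rewrite in_itv /= => xab.
  exact: (@ex_derive _ _ _ _ _ _ _ (fdf xab)).
by rewrite in_itv /= => xab ->; rewrite ler_wpM2r ?subr_ge0 // cdf.
Qed.

End DifferentialInequalities.

Section InverseGrowth.
Variables (R : realType) (f df : R -> R) (a b k : R).
Hypotheses (ab : a <= b)
  (fdf : forall x, a <= x <= b -> is_derive x 1 f (df x)).

Section Inverse.
Hypothesis f_gt0 : forall x, a <= x <= b -> 0 < f x.

Let derive_inv x : a <= x <= b ->
  is_derive x 1 (fun y => (f y)^-1) (- (f x) ^- 2 *: df x).
Proof. by move=> xab; apply: is_deriveV (fdf xab); rewrite gt_eqF ?f_gt0. Qed.

Lemma inv_growth_ge : (forall x, a <= x <= b -> k * f x ^+ 2 <= df x) ->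
  k * (b - a) <= (f a)^-1 - (f b)^-1.
Proof.
move=> kdf.
have := @is_derive_ge_le R (fun y => - (f y)^-1) (fun x => - (- (f x) ^- 2 *: df x)) a b ab.
move=> /(_ _ k) H; rewrite [leRHS](_ : _ = - (f b)^-1 - - (f a)^-1); last by ring.
apply: H => x xab; first exact: is_deriveN (derive_inv xab).
by rewrite scaleNr opprK /GRing.scale /= mulrC ler_pdivlMr ?exprn_gt0 ?f_gt0 // kdf.
Qed.

Lemma inv_growth_le : (forall x, a <= x <= b -> df x <= k * f x ^+ 2) ->
  (f a)^-1 - (f b)^-1 <= k * (b - a).
Proof.
move=> kdf.
have := @is_derive_ge_le R (fun y => (f y)^-1) (fun x => (- (f x) ^- 2 *: df x)) a b ab derive_inv (- k).
move=> H; rewrite -lerN2 opprB -mulNr; apply: H => x xab.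
by rewrite scaleNr lerN2 /GRing.scale /= mulrC ler_pdivrMr ?exprn_gt0 ?f_gt0 // kdf.
Qed.

End Inverse.

Lemma exp_growth_ge : (forall x, a <= x <= b -> k * f x <= df x) ->
  f a <= f b * expR (- (k * (b - a))).
Proof.
move=> kdf; have dE (x : R) : is_derive x 1 (fun y => expR (- k * y)) (expR (- k * x) * - k).
  have d1 : is_derive x 1 (fun y : R => - k * y) (- k).
    have := @is_deriveZ _ _ _ (fun y : R => y) (- k) x 1 1 (is_derive_id x 1).
    by rewrite /GRing.scale /= mulr1.
  exact: (is_derive1_comp (is_derive_expR _) d1).
have := @is_derive_ge_le R (f * (fun y => expR (- k * y)))
  (fun x => f x *: (expR (- k * x) * - k) + expR (- k * x) *: df x) a b ab.
move=> /(_ _ 0); rewrite mul0r subr_ge0 => H.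
have : f a * expR (- k * a) <= f b * expR (- k * b).
  apply: H => x xab; first by apply: is_deriveM (fdf xab) (dE x).
  rewrite /GRing.scale /=.
  have := mulr_ge0 (expR_ge0 (- k * x)) (_ : 0 <= df x - k * f x).
  by rewrite subr_ge0 kdf // => /(_ isT); lra.
rewrite -ler_pdivlMr ?expR_gt0 // -expRN -mulrA -expRD.
by rewrite (_ : - k * b + - (- k * a) = - (k * (b - a))) //; ring.
Qed.

End InverseGrowth.

(** * Russo's formula as a derivative, and monotonicity in the parameter *)

Section RussoDerivative.
Variables (R : realType) (T : finType).
Implicit Types (S : {set T}) (X : {set T} -> R).

Lemma is_derive_bex S X (p : R) : is_derive p 1 (fun q => bex q S X) (russo p S X).
Proof.
elim/set_ind: S X => [|e S eS IH] X.
  have -> : (fun q => bex q finset.set0 X) = cst (X finset.set0).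
    by apply/funext => q; rewrite bex_set0.
  by rewrite /russo big_set0; apply: is_derive_cst.
have -> : (fun q => bex q (e |: S) X) =
   (id * (fun q => bex q S (fun w => X (e |: w)))) + ((cst 1 - id) * (fun q => bex q S X)).
  by apply/funext => q; rewrite bexU1.
rewrite (russoU1 p X eS).
have d1 := is_deriveM (is_derive_id p (1 : R)) (IH (fun w => X (e |: w))).
have d2 := is_deriveM (is_deriveB (is_derive_cst (1 : R) p 1) (is_derive_id p (1 : R))) (IH X).
apply: is_derive_eq (is_deriveD d1 d2) _.
by rewrite /GRing.scale /= !fctE /=; ring.
Qed.

End RussoDerivative.

Section SubcriticalGraph.
Variables (R : realType) (G : sgraph) (m : nat) (o : G).
Hypotheses (trG : vertex_transitive G) (regG : regular_of_degree G m).
Local Notation E := (edges G).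
Local Notation chi := (fun p : R => mean p o (fun n => n%:R)).
Local Notation dchi := (fun p : R => dmean p o (fun n => n%:R)).

Lemma is_derive_mean h (p : R) : is_derive p 1 (fun q : R => mean q o h) (dmean p o h).
Proof. exact: is_derive_bex. Qed.

Lemma dmean_ge0 p h : 0 <= p <= 1 -> {homo h : i j / (i <= j)%N >-> i <= j :> R} ->
  0 <= dmean p o h.
Proof.
move=> p01 mh; apply: sumr_ge0 => e _; apply: bex_ge0 => // w _; rewrite subr_ge0.
apply: mh; apply: subset_leq_card; apply: open_clusterS.
exact: fintype.subset_trans (finset.subsetDl _ _) (finset.subsetUr _ _).
Qed.

Lemma homo_natr : {homo (fun n => n%:R : R) : i j / (i <= j)%N >-> i <= j}.
Proof. by move=> i j; rewrite ler_nat. Qed.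

Lemma mean_homo p q h : {homo h : i j / (i <= j)%N >-> i <= j :> R} ->
  0 <= p -> p <= q -> q <= 1 -> mean p o h <= mean q o h.
Proof.
move=> mh p0 pq q1; rewrite -subr_ge0 -[leLHS](mul0r (q - p)).
apply: (is_derive_ge_le (f := fun p => mean p o h) pq (fun x _ => is_derive_mean h x)).
by move=> x /andP[px xq]; apply: dmean_ge0; rewrite // (le_trans p0 px) (le_trans xq q1).
Qed.

Lemma mean_IVT p q v : 0 <= p -> p <= q -> q <= 1 -> chi p <= v <= chi q ->
  exists2 r, p <= r <= q & chi r = v.
Proof.
move=> p0 pq q1 pvq; have le := mean_homo homo_natr p0 pq q1.
have [|| r] := @IVT R chi p q v pq.
- apply: derivable_within_continuous => x _.
  exact: (@ex_derive _ _ _ _ _ _ _ (is_derive_mean (fun n => n%:R) x)).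
- by rewrite (min_idPl le) (max_idPr le).
by rewrite in_itv /= => ? <-; exists r.
Qed.

Lemma mean0 h : mean (0 : R) o h = h 1%N.
Proof.
have ex0 S (X : {set {set G}} -> R) : bex 0 S X = X finset.set0.
  elim/set_ind: S X => [|e S eS IH] X; first by rewrite bex_set0.
  by rewrite bexU1 // mul0r add0r subr0 mul1r.
rewrite /mean ex0; congr h; rewrite -(cards1 o); apply: eq_card => x.
have : open_cluster finset.set0 o \subset [set o]%SET.
  by apply: open_cluster_min => [|y z _ /andP[_]]; rewrite ?finset.in_set1 ?finset.in_set0.
move=> /fintype.subsetP sub; apply/idP/idP; first exact: sub.
by rewrite finset.in_set1 => /eqP ->; apply: open_cluster_refl.
Qed.

Lemma chi_le_growth p q : 0 <= p -> p <= q -> q <= 1 ->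
  (chi p)^-1 - (chi q)^-1 <= m%:R * (q - p).
Proof.
move=> p0 pq q1; apply: inv_growth_le => // x /andP[px xq].
- exact: is_derive_mean.
- by apply: chi_gt0; rewrite (le_trans p0 px) (le_trans xq q1).
by apply: dchi_le => //; rewrite (le_trans p0 px) (le_trans xq q1).
Qed.

End SubcriticalGraph.

(** * The mean-field regime *)

Section MeanFieldRegime.
Variables (R : realType) (G : sgraph) (m : nat) (o : G) (p1 : R).
Hypotheses (trG : vertex_transitive G) (regG : regular_of_degree G m).
Hypothesis m_gt0 : (0 < m)%N.
Hypothesis p1_01 : 0 <= p1 <= 1.
Hypothesis nabla_le : forall p (a b : G), 0 <= p <= p1 -> adj a b -> nabla p a b <= 2^-1.
Local Notation E := (edges G).
Local Notation chi := (fun p : R => mean p o (fun n => n%:R)).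
Local Notation dchi := (fun p : R => dmean p o (fun n => n%:R)).
Local Notation chi2 := (fun p : R => mean p o (fun n => n%:R ^+ 2)).

Let m0 : 0 < m%:R :> R. Proof. by rewrite ltr0n. Qed.

Let p01 p : 0 <= p <= p1 -> 0 <= p <= 1.
Proof. by case/andP=> -> pp; apply: le_trans pp _; case/andP: p1_01. Qed.

Lemma dchi_ge_half p : 0 <= p <= p1 -> m%:R / 2 * chi p ^+ 2 <= dchi p.
Proof.
move=> pp1; apply: le_trans (dchi_ge o trG regG (p01 pp1) (s := 2^-1) _); last first.
  by move=> a b ab; apply: nabla_le.
by rewrite -mulrA ler_pM2l //; lra.
Qed.

Lemma chi_ge_growth p q : 0 <= p -> p <= q -> q <= p1 ->
  m%:R / 2 * (q - p) <= (chi p)^-1 - (chi q)^-1.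
Proof.
move=> p0 pq qp; apply: inv_growth_ge => // x /andP[px xq].
- exact: is_derive_mean.
- by apply: chi_gt0; apply: p01; rewrite (le_trans p0 px) (le_trans xq qp).
by apply: dchi_ge_half; rewrite (le_trans p0 px) (le_trans xq qp).
Qed.

(** 1 / chi starts at 1 when p = 0, decreases at rate at least m / 2 and stays positive. *)
Lemma degree_mul_le2 : m%:R * p1 <= 2.
Proof.
case/andP: (p1_01) => p0 p1'; have := chi_ge_growth (lexx 0) p0 (lexx p1).
have := chi_gt0 o p1_01; rewrite -invr_gt0 mean0; lra.
Qed.

(** 1 / chi has dropped from 1 to at most 1/2, at rate at most m. *)
Lemma degree_mul_ge p : 0 <= p <= 1 -> 2 <= chi p -> 1 <= 2 * (m%:R * p).
Proof.
move=> /andP[p0 p1'] chip; have := chi_le_growth o trG regG (lexx 0) p0 p1'.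
rewrite mean0 invr1 subr0.
have : (chi p)^-1 <= 2^-1 by rewrite lef_pV2 // posrE; lra.
lra.
Qed.

Hypothesis m_ge4 : (4 <= m)%N.

Let p1_half : p1 <= 2^-1.
Proof.
have := degree_mul_le2; have : (4%:R : R) <= m%:R by rewrite ler_nat.
by case/andP: (p1_01) => p0 _; nra.
Qed.

Lemma chi2_ge p : 0 <= p <= p1 -> 2 <= chi p -> chi p ^+ 3 <= 16 * chi2 p.
Proof.
move=> pp1 chip; have := dchi_sqr_le o regG (p01 pp1).
have := degree_mul_ge (p01 pp1) chip; have := dchi_ge_half pp1.
case/andP: pp1 => p0 pp1; set u := chi p in chip *; set v := dchi p; set s := chi2 p.
move: m0; set M : R := m%:R => M0.
move=> vge mp; set q := p * (1 - p) => H.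
(* The constant 16 is 4 times 4: one factor from squaring chi' >= m chi^2 / 2, the other from m p (1
   - p) >= 1/4, which holds as m p >= 1/2 and p <= 1/2. *)
have mq : 4^-1 <= M * q.
  rewrite /q mulrA; have := p1_half; nra.
have u0 : 0 < u by lra.
have q0 : 0 < q by rewrite -(pmulr_rgt0 _ M0); lra.
have H2 : (q * (M / 2 * u ^+ 2)) ^+ 2 <= s * (q * (M * u)).
  apply: le_trans H; rewrite ler_sqr ?nnegrE ?ler_pM2l //.
    by rewrite mulr_ge0 ?(ltW q0) // mulr_ge0 ?sqr_ge0 // divr_ge0 // ltW.
  apply: mulr_ge0; first exact: ltW.
  by apply: le_trans vge; rewrite mulr_ge0 ?sqr_ge0 // divr_ge0 // ltW.
have H3 : (q * M * u) * (q * M * u ^+ 3) <= (q * M * u) * (4 * s).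
  rewrite (_ : (q * M * u) * (4 * s) = 4 * (s * (q * (M * u)))); last by ring.
  rewrite (_ : (q * M * u) * (q * M * u ^+ 3) = 4 * (q * (M / 2 * u ^+ 2)) ^+ 2); last by field.
  by rewrite ler_pM2l.
rewrite (ler_pM2l (mulr_gt0 (mulr_gt0 q0 M0) u0)) in H3.
have : 4^-1 * u ^+ 3 <= q * M * u ^+ 3 by rewrite ler_pM2r ?exprn_gt0 // mulrC.
lra.
Qed.

(** OSSS with h = id, where p chi' <= m p chi^2 <= 2 chi^2, bounds the second moment by chi^2 + 4
    chi^3, and chi >= 1. *)
Lemma chi2_le p : 0 <= p <= p1 -> chi2 p <= 5 * chi p ^+ 3.
Proof.
move=> pp1; have := osss_mean o trG (p01 pp1) (h := fun n => n%:R) (@homo_natr R).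
rewrite (_ : mean p o (fun n => n%:R * n%:R) = chi2 p); last first.
  by apply: eq_bex => w _; rewrite expr2.
have := dchi_le o trG regG (p01 pp1); have := chi_ge1 o (p01 pp1).
have := dmean_ge0 o (p01 pp1) (@homo_natr R).
case/andP: pp1 => p0 pp1; have := degree_mul_le2.
set u := chi p; set v := dchi p; move: m0; set s := chi2 p; set M : R := m%:R => M0.
move=> Mp1 v0 u1 vle H.
have Mp : M * p <= 2 by apply: le_trans Mp1; rewrite ler_pM2l.
have H1 : p * (1 - p) * v <= p * v.
  by rewrite -mulrA ler_wpM2l // ler_piMl //; lra.
have H2 : p * v <= 2 * u ^+ 2.
  apply: le_trans (ler_wpM2l p0 vle) _.
  by rewrite mulrA [p * M]mulrC ler_wpM2r ?sqr_ge0.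
have H3 : 2 * u * (p * (1 - p) * v) <= 2 * u * (2 * u ^+ 2).
  by rewrite ler_wpM2l ?(le_trans H1) // mulr_ge0 //; lra.
have H4 : u * u <= u ^+ 3 by rewrite exprS ler_wpM2l ?expr2 ?ler_peMl //; lra.
have -> : 5 * u ^+ 3 = u ^+ 3 + 2 * u * (2 * u ^+ 2) by ring.
lra.
Qed.

(* Raising [p] until the susceptibility doubles multiplies the mean of any
   function supported on clusters of size [>= N] by [exp (N / (32 chi ^ 2))]. *)
Lemma mean_tail p q h N : 0 < p -> p <= q -> q <= p1 -> chi q = 2 * chi p ->
  4 * chi p <= N -> (forall n, 0 <= h n) ->
  {homo h : i j / (i <= j)%N >-> i <= j} -> (forall n, n%:R < N -> h n = 0) ->
  mean p o h <= mean q o h * expR (- (N / (32 * chi p ^+ 2))).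
Proof.
move=> p0 pq qp1 chiq N4 h0 mh hN.
have pp : 0 <= p <= p1 by rewrite (ltW p0) (le_trans pq qp1).
have qq : 0 <= q <= p1 by rewrite (le_trans (ltW p0) pq) qp1.
have q0 : 0 < q by apply: lt_le_trans pq.
have c1 := chi_ge1 o (p01 pp).
have c0 : 0 < chi p by apply: chi_gt0; apply: p01.
set u := chi p in chiq N4 c1 c0 *.
have N0 : 0 < N by lra.
(* For [h] supported on sizes at least [N], E |C| h >= N E h. On [p, q] one has chi <= 2 u <= N / 2,
   so OSSS leaves (N / 2) E h <= 4 u q (E h)'. *)
set k := N / (8 * u * q).
have kge r : p <= r <= q -> k * mean r o h <= dmean r o h.
  move=> /andP[pr rq]; have rr : 0 <= r <= 1.
    by apply: p01; rewrite (le_trans (ltW p0) pr) (le_trans rq qp1).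
  have := osss_mean o trG rr mh.
  have cr : chi r <= 2 * u.
    rewrite -chiq; apply: mean_homo => //; first exact: homo_natr.
      by case/andP: rr.
    by case/andP: (p01 qq).
  have M0 : 0 <= mean r o h by apply: mean_ge0.
  have D0 : 0 <= dmean r o h by apply: dmean_ge0.
  have Nh : N * mean r o h <= mean r o (fun n => n%:R * h n).
    rewrite /mean -bexZ; apply: le_bex => // w _.
    have [hn|hn] := ltP #|open_cluster w o|%:R N; first by rewrite hN // !mulr0.
    by rewrite ler_wpM2r.
  have c1r : 1 <= chi r by apply: chi_ge1.
  move=> H; set v := chi r in cr c1r H *; set M := mean r o h in M0 Nh H *; set D := dmean r o h in D0 H *.
  have rq' : r * (1 - r) * D <= q * D.
    apply: ler_wpM2r => //; have r1 : r * (1 - r) <= r by case/andP: rr => ? ?; rewrite ler_piMr //; lra.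
    by apply: le_trans rq.
  have H1 : 2 * v * (r * (1 - r) * D) <= 4 * u * (q * D).
    apply: ler_pM; rewrite ?rq' //; [lra | | lra].
    by rewrite mulr_ge0 // mulr_ge0 //; case/andP: rr => ? ?; rewrite ?subr_ge0.
  have H2 : v * M <= N / 2 * M by rewrite ler_wpM2r //; lra.
  have H3 : N / 2 * M <= 4 * u * (q * D) by lra.
  rewrite /k mulrAC ler_pdivrMr; last by rewrite !mulr_gt0.
  by rewrite (_ : D * (8 * u * q) = 2 * (4 * u * (q * D))); lra.
apply: le_trans (exp_growth_ge pq (fun r _ => is_derive_mean o h r) kge) _.
apply: ler_wpM2l; first by apply: mean_ge0 => //; apply: p01.
rewrite ler_expR lerN2.
have := chi_le_growth o trG regG (ltW p0) pq _; rewrite (_ : q <= 1); last by case/andP: (p01 qq).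
move=> /(_ isT); rewrite chiq -/u => H.
have mq : m%:R * q <= 2.
  by apply: le_trans degree_mul_le2; rewrite ler_pM2l.
(* Doubling chi requires m (q - p) >= 1 / (2 u), and m q <= 2; hence k (q - p) >= N / (32 u^2). *)
have -> : k * (q - p) = (N / (8 * u * (m%:R * q))) * (m%:R * (q - p)).
  rewrite /k; field; rewrite !gt_eqF //.
apply: le_trans (_ : N / (8 * u * (m%:R * q)) * (u^-1 - (2 * u)^-1) <= _); last first.
  by rewrite ler_wpM2l // divr_ge0 ?ltW // !mulr_gt0.
have -> : N / (8 * u * (m%:R * q)) * (u^-1 - (2 * u)^-1) = N / (16 * u ^+ 2 * (m%:R * q)).
  by field; rewrite !gt_eqF.
apply: ler_wpM2l; first exact: ltW.
rewrite lef_pV2 ?posrE ?mulr_gt0 ?exprn_gt0 //.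
rewrite (_ : 32 * u ^+ 2 = 16 * u ^+ 2 * 2); last by ring.
by rewrite ler_wpM2l // mulr_ge0 ?sqr_ge0.
Qed.

Lemma chi_double p : 0 <= p <= p1 -> 2 * chi p <= chi p1 ->
  exists q, [/\ p <= q, q <= p1 & chi q = 2 * chi p].
Proof.
move=> pp1 c2; case/andP: (pp1) => p0 pp; have c1 := chi_ge1 o (p01 pp1).
have p1le : p1 <= 1 by case/andP: p1_01.
have [|r /andP[pr rp] cr] := @mean_IVT R G o p p1 (2 * chi p) p0 pp p1le.
  by rewrite c2 andbT; lra.
by exists r.
Qed.

Definition tail p (N : R) : R := mean p o (fun n => (N <= n%:R)%R%:R).

Lemma tail_homo (N : R) : {homo (fun n => (N <= n%:R)%R%:R : R) : i j / (i <= j)%N >-> i <= j}.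
Proof.
move=> i j ij; rewrite ler_nat; have [Ni|//] := boolP (N <= i%:R).
by rewrite (le_trans Ni) // ler_nat.
Qed.

(** The prefactor is Markov's inequality at the parameter where chi has doubled. *)
Lemma tail_le p N : 0 < p -> p <= p1 -> 2 * chi p <= chi p1 -> 4 * chi p <= N ->
  tail p N <= 2 * chi p / N * expR (- (N / (32 * chi p ^+ 2))).
Proof.
move=> p0 pp1 c2 N4; have pp : 0 <= p <= p1 by rewrite (ltW p0).
have [q [pq qp1 cq]] := chi_double pp c2.
have c0 : 0 < chi p by apply: chi_gt0; apply: p01.
have N0 : 0 < N by apply: lt_le_trans N4; rewrite mulr_gt0.
apply: le_trans (mean_tail p0 pq qp1 cq N4 _ (@tail_homo N) _) _ => [//|n|].
  by move=> nN; rewrite leNgt nN.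
apply: ler_wpM2r; first exact: expR_ge0.
rewrite -cq ler_pdivlMr // /tail /mean -bexZr.
have qq : 0 <= q <= 1 by apply: p01; rewrite (le_trans (ltW p0) pq).
apply: le_bex => // w _; have [h|h] := boolP (N <= _); first by rewrite mul1r.
by rewrite mul0r.
Qed.

(** The factor 40 is 5 times 2^3, from [chi2_le] at the doubled susceptibility. *)
Lemma chi2_tail p N : 0 < p -> p <= p1 -> 2 * chi p <= chi p1 -> 4 * chi p <= N ->
  mean p o (fun n => n%:R ^+ 2 * (N <= n%:R)%R%:R) <=
    40 * chi p ^+ 3 * expR (- (N / (32 * chi p ^+ 2))).
Proof.
move=> p0 pp1 c2 N4; have pp : 0 <= p <= p1 by rewrite (ltW p0).
have [q [pq qp1 cq]] := chi_double pp c2.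
have qq : 0 <= q <= p1 by rewrite (le_trans (ltW p0) pq).
apply: le_trans (mean_tail p0 pq qp1 cq N4 _ _ _) _ => [n|i j ij|n|].
- by rewrite mulr_ge0 ?sqr_ge0.
- apply: ler_pM; rewrite ?sqr_ge0 ?tail_homo //.
  by rewrite -!natrX ler_nat leq_exp2r.
- by move=> nN; rewrite leNgt nN mulr0.
apply: ler_wpM2r; first exact: expR_ge0.
apply: le_trans (_ : chi2 q <= _); last first.
  by apply: le_trans (chi2_le qq) _; rewrite cq exprMn; lra.
apply: le_bex => [|w _]; first exact: p01.
by rewrite ler_piMr ?sqr_ge0 // lern1 leq_b1.
Qed.

End MeanFieldRegime.

(** * Lower bound on the tail of the cluster size *)

Section Likelihood.
Variable R : realType.

Lemma score_card (G : sgraph) (q : R) (E : {set {set G}}) (B : {set G}) w :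
  score q E B w = #|w :&: touch E B|%:R - q * #|touch E B|%:R.
Proof.
rewrite /score sumrB; congr (_ - _); last by rewrite sumr_const mulr_natr.
rewrite -sum1_card natr_sum (big_mkcond [in _ :&: _]) [LHS]big_mkcond /=.
by apply: eq_bigr => e _; rewrite finset.in_setI andbC; case: (e \in touch E B); case: (e \in w).
Qed.

(* With [Z = i - q (i + j)], the exponents add up to
   [- eta ^ 2 q (i + j) / ((1 - p) (1 - eta)) - eta Z (1 / (1 - eta) + q / (1 - p))]. *)
Lemma likelihood_ratio_ge (p q eta z : R) (i j : nat) :
  0 < q -> q <= 2^-1 -> 0 <= eta <= 2^-1 -> p = q * (1 - eta) ->
  `|i%:R - q * (i + j)%:R| <= z ->
  expR (- (4 * eta ^+ 2 * (q * (i + j)%:R) + 3 * eta * z)) * (q ^+ i * (1 - q) ^+ j)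
  <= p ^+ i * (1 - p) ^+ j.
Proof.
move=> q0 q2 /andP[e0 e2] pE; rewrite ler_norml natrD => /andP[z1 z2].
have p0 : 0 < p by rewrite pE mulr_gt0 //; lra.
have pq : p <= q by rewrite pE; nra.
have h1 : expR (- (eta / (1 - eta))) * q <= p.
  rewrite pE mulrC ler_pM2l // expRN invf_ple ?posrE ?expR_gt0 //; last by lra.
  apply: le_trans (expR_ge1Dx _); apply: eq_ler.
  by field; lra.
have h2 : expR (eta * q / (1 - p)) * (1 - q) <= 1 - p.
  rewrite -ler_pdivlMr ?subr_gt0; last by lra.
  rewrite -[leRHS]invf_div -[X in expR X]opprK expRN lef_pV2 ?posrE ?expR_gt0 ?divr_gt0 ?subr_gt0; try lra.
  apply: le_trans (expR_ge1Dx _); apply: eq_ler.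
  by rewrite pE; field; nra.
have g1 : expR (i%:R * - (eta / (1 - eta))) * q ^+ i <= p ^+ i.
  by rewrite expRM_natl -exprMn lerXn2r ?nnegrE ?mulr_ge0 ?expR_ge0 // ltW.
have g2 : expR (j%:R * (eta * q / (1 - p))) * (1 - q) ^+ j <= (1 - p) ^+ j.
  by rewrite expRM_natl -exprMn lerXn2r ?nnegrE ?mulr_ge0 ?expR_ge0 ?subr_ge0 //; lra.
have q1 : 0 <= (1 - q) ^+ j by rewrite exprn_ge0 //; lra.
have q1' : 0 <= q ^+ i by rewrite exprn_ge0 // ltW.
apply: le_trans (ler_pM _ _ g1 g2); try by rewrite mulr_ge0 ?expR_ge0.
rewrite [leRHS]mulrACA -expRD ler_wpM2r ?mulr_ge0 // ler_expR.
set I : R := i%:R in z1 z2 *; set J : R := j%:R in z1 z2 *.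
have I0 : 0 <= I by apply: ler0n.
have J0 : 0 <= J by apply: ler0n.
set Z := I - q * (I + J) in z1 z2.
have a1 : (1 - eta)^-1 <= 2 by rewrite invf_ple ?posrE; lra.
have a2 : (1 - p)^-1 <= 2 by rewrite invf_ple ?posrE; lra.
have b1 : 0 < (1 - eta)^-1 by rewrite invr_gt0; lra.
have b2 : 0 < (1 - p)^-1 by rewrite invr_gt0; lra.
have -> : I * - (eta / (1 - eta)) + J * (eta * q / (1 - p)) =
  - (eta ^+ 2 * (q * (I + J)) * ((1 - eta)^-1 * (1 - p)^-1)
     + eta * Z * ((1 - eta)^-1 + q * (1 - p)^-1)).
  by rewrite /Z pE; field; nra.
rewrite lerN2; apply: lerD.
  rewrite (_ : 4 * eta ^+ 2 * (q * (I + J)) = eta ^+ 2 * (q * (I + J)) * (2 * 2)); last by ring.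
  apply: ler_wpM2l; first by rewrite mulr_ge0 ?sqr_ge0 // mulr_ge0 ?addr_ge0 // ltW.
  by apply: ler_pM => //; apply: ltW.
have Zz : Z <= z by [].
have z0 : 0 <= z by lra.
set s := _ + _; have s0 : 0 <= s by rewrite addr_ge0 ?mulr_ge0 ?ltW.
have s3 : s <= 3.
  have : q * (1 - p)^-1 <= 2^-1 * 2 by apply: ler_pM => //; apply: ltW.
  by rewrite /s; lra.
apply: le_trans (_ : eta * z * s <= _).
  by rewrite ler_wpM2r // ler_wpM2l.
by rewrite (_ : 3 * eta * z = eta * z * 3) ?ler_wpM2l ?mulr_ge0 //; ring.
Qed.

End Likelihood.

Section LargeCluster.
Variables (R : realType) (G : sgraph) (m : nat) (o : G) (p1 : R).
Hypotheses (trG : vertex_transitive G) (regG : regular_of_degree G m).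
Hypothesis m_ge4 : (4 <= m)%N.
Hypothesis p1_01 : 0 <= p1 <= 1.
Hypothesis nabla_le : forall p (a b : G), 0 <= p <= p1 -> adj a b -> nabla p a b <= 2^-1.
Local Notation E := (edges G).
Local Notation chi := (fun p : R => mean p o (fun n => n%:R)).
Local Notation chi2 := (fun p : R => mean p o (fun n => n%:R ^+ 2)).

Let m_gt0 : (0 < m)%N. Proof. exact: leq_trans m_ge4. Qed.
Let m0 : 0 < m%:R :> R. Proof. by rewrite ltr0n. Qed.
Let p01 p : 0 <= p <= p1 -> 0 <= p <= 1.
Proof. by case/andP=> -> pp; apply: le_trans pp _; case/andP: p1_01. Qed.

(* [K] is a cutoff such that clusters larger than [K chi ^ 2] contribute
   little to the second moment. *)
Variable K : R.
Hypotheses (K_ge4 : 4 <= K) (K_exp : 40 * expR (- (K / 32)) <= 64^-1).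
Let K0 : 0 < K. Proof. by apply: lt_le_trans K_ge4. Qed.

Definition typical u : nat -> bool := fun n => (u ^+ 2 / 64 <= n%:R < K * u ^+ 2).

(** The second moment is at least u^3 / 16. Sizes below u^2 / 64 contribute at most u^3 / 64, and so
    do those above K u^2 by the choice of [K]. The remaining u^3 / 32 comes from sizes whose square
    is at most K^2 u^4. *)
Lemma typical_mass p : 0 < p -> p <= p1 -> 2 <= chi p -> 2 * chi p <= chi p1 ->
  (32 * K ^+ 2 * chi p)^-1 <= mean p o (fun n => (typical (chi p) n)%:R).
Proof.
move=> p0 pp1 c2 c2'; have pp : 0 <= p <= p1 by rewrite (ltW p0).
have lo := chi2_ge trG regG m_gt0 p1_01 nabla_le m_ge4 pp c2.
have := @chi2_tail R G m o p1 trG regG m_gt0 p1_01 nabla_le p (K * chi p ^+ 2) p0 pp1 c2'.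
move: lo; set u := chi p in c2 *; move=> lo.
have u0 : 0 < u by lra.
have -> : K * u ^+ 2 / (32 * u ^+ 2) = K / 32 by field; rewrite ?gt_eqF //.
have Ku : 4 * u <= K * u ^+ 2.
  rewrite expr2 mulrA ler_wpM2r ?ltW //; have := K_ge4; nra.
move=> /(_ Ku) hi.
have hi' : mean p o (fun n => n%:R ^+ 2 * (K * u ^+ 2 <= n%:R)%R%:R) <= u ^+ 3 / 64.
  apply: le_trans hi _; rewrite [40 * _]mulrC -mulrA.
  by rewrite ler_wpM2l ?exprn_ge0 // ltW.
have : chi2 p <= u ^+ 2 / 64 * u + (K * u ^+ 2) ^+ 2 * mean p o (fun n => (typical u n)%:R)
   + mean p o (fun n => n%:R ^+ 2 * (K * u ^+ 2 <= n%:R)%R%:R).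
  have -> : u ^+ 2 / 64 * u = bex p E (fun w => u ^+ 2 / 64 * #|open_cluster w o|%:R).
    by rewrite bexZ.
  rewrite /mean -[_ ^+ 2 * bex _ _ _]bexZ -!bexD.
  apply: le_bex => [|w _]; first exact: p01.
  rewrite /typical; set n := #|_|.
  have [h1|h1] := ltP n%:R (u ^+ 2 / 64).
    apply: le_trans (_ : n%:R ^+ 2 <= u ^+ 2 / 64 * n%:R) _.
      by rewrite expr2 ler_wpM2r // ltW.
    by rewrite -addrA lerDl addr_ge0 // mulr_ge0 // sqr_ge0.
  have [h2|h2] := ltP n%:R (K * u ^+ 2) => /=.
    rewrite mulr1 mulr0 addr0; apply: le_trans (_ : _ <= (K * u ^+ 2) ^+ 2) _.
      by rewrite lerXn2r ?nnegrE // ?mulr_ge0 ?sqr_ge0 // ltW.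
    by rewrite lerDr mulr_ge0 // divr_ge0 // sqr_ge0.
  by rewrite mulr0 addr0 mulr1 lerDr mulr_ge0 // divr_ge0 // sqr_ge0.
set M := mean p o (fun n => (typical u n)%:R); move=> H.
have H' : u ^+ 3 / 32 <= (K * u ^+ 2) ^+ 2 * M.
  have E3 : u ^+ 2 / 64 * u = u ^+ 3 / 64 by field.
  rewrite E3 in H; move: lo hi' H; rewrite /=.
  set C2 := mean p o (fun n => n%:R ^+ 2); set H2 := mean p o (fun n => _ * _).
  by lra.
have := ler_wpM2r (_ : 0 <= ((K * u ^+ 2) ^+ 2)^-1) H'.
rewrite invr_ge0 sqr_ge0 => /(_ isT).
rewrite [_ * M]mulrC mulfK; last by rewrite gt_eqF // exprn_gt0 // mulr_gt0 // exprn_gt0.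
apply: le_trans; apply: eq_ler.
by field; rewrite ?gt_eqF //.
Qed.

Definition typical_score q u (B : {set G}) (t : {set {set G}}) :=
  typical u #|B| && (`|#|t|%:R - q * #|touch E B|%:R| <= 12 * K * u).

(** The score has second moment at most 2 u, so Chebyshev at 12 K u excludes probability at most 1 /
    (72 K^2 u), less than half of [typical_mass]. *)
Lemma typical_score_mass q : 0 < q -> q <= p1 -> 2 <= chi q -> 2 * chi q <= chi p1 ->
  (64 * K ^+ 2 * chi q)^-1 <= bex q E (fun w =>
    (typical_score q (chi q) (open_cluster w o) (w :&: touch E (open_cluster w o)))%:R).
Proof.
move=> q0 qp1 c2 c2'; have qq : 0 <= q <= p1 by rewrite (ltW q0).
have mass := typical_mass q0 qp1 c2 c2'; move: mass.
have := cluster_score_sqr o regG (p01 qq).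
set u := chi q in c2 *; move=> Z2 mass.
have u0 : 0 < u by lra.
set z := 12 * K * u; have z0 : 0 < z by rewrite /z !mulr_gt0.
have Z2' : bex q E (fun w => cluster_score o q w ^+ 2) <= 2 * u.
  apply: le_trans Z2 _.
  have := degree_mul_le2 o trG regG m_gt0 p1_01 nabla_le.
  have qm : m%:R * q <= m%:R * p1 by rewrite ler_pM2l.
  move=> mp; have /andP[q0' q1] := p01 qq.
  rewrite (_ : q * (1 - q) * (m%:R * u) = (m%:R * q) * (1 - q) * u); last by ring.
  rewrite ler_wpM2r ?(ltW u0) // -[leRHS]mulr1; apply: ler_pM.
  - by rewrite mulr_ge0.
  - by rewrite subr_ge0.
  - exact: le_trans mp.
  - by rewrite gerBl.
have bad : bex q E (fun w => (z < `|cluster_score o q w|)%R%:R) <= 2 * u / z ^+ 2.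
  rewrite ler_pdivlMr ?exprn_gt0 //; apply: le_trans Z2'; rewrite -bexZr.
  apply: le_bex => [|w _]; first exact: p01.
  have [h|h] := ltP z `|cluster_score o q w|; last by rewrite mul0r sqr_ge0.
  by rewrite mul1r -[leRHS]real_normK ?num_real // lerXn2r ?nnegrE // ltW.
have : mean q o (fun n => (typical u n)%:R) <= bex q E (fun w =>
    (typical_score q u (open_cluster w o) (w :&: touch E (open_cluster w o)))%:R)
   + bex q E (fun w => (z < `|cluster_score o q w|)%R%:R).
  rewrite -bexD; apply: le_bex => [|w _]; first exact: p01.
  rewrite /typical_score /cluster_score score_card.
  case: (typical u _) => /=; last by rewrite add0r.
  by case: leP => _ /=; rewrite ?add0r ?addr0.
set X := bex q E _ in bad *; set Y := bex q E _.
have zE : 2 * u / z ^+ 2 = (72 * K ^+ 2 * u)^-1 by rewrite /z; field; rewrite ?gt_eqF //.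
rewrite zE in bad.
have e1 : (32 * K ^+ 2 * u)^-1 = 2 * (64 * K ^+ 2 * u)^-1 by field; rewrite ?gt_eqF //.
have e2 : (72 * K ^+ 2 * u)^-1 <= (64 * K ^+ 2 * u)^-1.
  rewrite lef_pV2 ?posrE ?mulr_gt0 ?exprn_gt0 // -!mulrA.
  apply: ler_wpM2r; last by rewrite ler_nat.
  by rewrite !mulr_ge0 ?(ltW K0) ?(ltW u0).
rewrite e1 in mass; lra.
Qed.

(** The exponent is that of [likelihood_ratio_ge] with q times the number of touching edges at most
    q m K u^2 <= 2 K u^2 and score at most 12 K u. *)
Lemma tail_change p q eta : 0 < q -> q <= p1 -> 2 <= chi q -> 2 * chi q <= chi p1 ->
  0 <= eta <= 2^-1 -> p = q * (1 - eta) ->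
  expR (- (8 * K * (eta * chi q) ^+ 2 + 36 * K * (eta * chi q))) / (64 * K ^+ 2 * chi q)
    <= tail o p (chi q ^+ 2 / 64).
Proof.
move=> q0 qp1 c2 c2' e01 pE; have mass := typical_score_mass q0 qp1 c2 c2'.
have mp1 := degree_mul_le2 o trG regG m_gt0 p1_01 nabla_le.
have q2 : q <= 2^-1.
  have : (4%:R : R) <= m%:R by rewrite ler_nat.
  by nra.
have p01' : 0 <= p <= 1 by case/andP: e01 => ? ?; rewrite pE; apply/andP; split; nra.
move: mass; set u := chi q in c2 *; move=> mass.
have u0 : 0 < u by lra.
set D := _ + _.
have e0 : 0 <= eta by case/andP: e01.
apply: le_trans (ler_wpM2l (expR_ge0 _) mass) _.
apply: le_trans (_ : _ <= bex p E (fun w =>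
    (typical_score q u (open_cluster w o) (w :&: touch E (open_cluster w o)))%:R)) _; last first.
  apply: le_bex => // w _; rewrite /typical_score /typical ler_nat.
  by case: (u ^+ 2 / 64 <= _) => //=; apply: leq_b1.
apply: change_of_measure => // w wE B T /andP[/andP[_ Blt] sc].
have cT : #|T| = (#|w :&: T| + #|T :\: w|)%N by rewrite -(cardsID w T) finset.setIC.
rewrite -/T cT in sc.
apply: le_trans (likelihood_ratio_ge q0 q2 e01 pE sc).
rewrite ler_wpM2r //; first by rewrite mulr_ge0 // exprn_ge0 // ?(ltW q0) // subr_ge0; lra.
rewrite ler_expR lerN2 -cT /D; apply: lerD; last by apply: eq_ler; ring.
have : q * #|T|%:R <= 2 * (K * u ^+ 2).
  apply: le_trans (_ : q * (m%:R * #|B|%:R) <= _).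
    by rewrite ler_wpM2l ?(ltW q0) // -natrM ler_nat card_touch.
  rewrite mulrA; apply: ler_pM => //; try lra.
    by rewrite mulr_ge0 // ltW.
    by apply: le_trans mp1; rewrite mulrC ler_pM2l.
move=> H; apply: le_trans (ler_wpM2l _ H) _; first by rewrite mulr_ge0 ?sqr_ge0.
by rewrite exprMn le_eqVlt; apply/orP; left; apply/eqP; ring.
Qed.

(* The comparison point [q >= p] is the one where [chi q ^ 2 / 64] equals the threshold. *)
Lemma tail_ge p pc eps A : p1 <= pc -> p = pc * (1 - eps) -> 0 < eps <= 2^-1 ->
  0 < p -> p <= p1 -> chi p <= 8 / eps -> 1 <= A -> 16 * A <= eps * chi p1 ->
  eps / (64 * K ^+ 2 * (8 * A)) *
    expR (- (8 * K * (64 * A) + 36 * K * (8 * A))) <= tail o p (A / eps ^+ 2).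
Proof.
move=> p1pc pE /andP[e0 e2] p0 pp1 chip A1 Ae.
have A0 : 0 < A by lra.
(* With chi q = 8 s / eps the cost has exponent of order s^2 + s; as A >= 1, s <= A makes it linear
   in [A]. *)
set s := Num.sqrt A; have sA : s ^+ 2 = A by rewrite sqr_sqrtr //; lra.
have s0 : 0 <= s by apply: sqrtr_ge0.
have s1 : 1 <= s by rewrite -(@ler_pXn2r _ 2) ?nnegrE // expr1n sA.
have sA' : s <= A by rewrite -sA expr2 ler_peMl.
have cq : 2 * (8 * s / eps) <= chi p1.
  rewrite (_ : 2 * (8 * s / eps) = 16 * s / eps); last by ring.
  by rewrite ler_pdivrMr // [leRHS]mulrC (le_trans _ Ae) //; lra.
have p1le : p1 <= 1 by case/andP: p1_01.
have [|q /andP[pq qp1] qE] := @mean_IVT R G o p p1 (8 * s / eps) (ltW p0) pp1 p1le.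
  apply/andP; split.
    by apply: le_trans chip _; rewrite ler_wpM2r ?invr_ge0 ?(ltW e0) //; lra.
  by apply: le_trans cq; rewrite ler_peMl ?divr_ge0 ?mulr_ge0 ?(ltW e0) //; lra.
have q0 : 0 < q by apply: lt_le_trans pq.
(* Since q <= p1 <= pc, the relative drop from [q] to [p] is at most the drop from [pc] to [p]. *)
have eE : 0 <= 1 - p / q <= eps.
  rewrite subr_ge0 ler_pdivrMr // mul1r pq /= lerBlDr -lerBlDl ler_pdivlMr //.
  rewrite pE mulrC ler_wpM2r; [|lra|exact: le_trans p1pc].
  by [].
case/andP: eE => eta0 eta_le.
have c2 : 2 <= chi q.
  rewrite qE ler_pdivlMr //; lra.
have := @tail_change p q (1 - p / q) q0 qp1 c2.
rewrite qE => /(_ cq); rewrite eta0 (le_trans eta_le e2) => /(_ isT) H.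
have /H : p = q * (1 - (1 - p / q)) by field; rewrite ?gt_eqF //.
rewrite (_ : (8 * s / eps) ^+ 2 / 64 = A / eps ^+ 2); last first.
  by rewrite -sA; field; rewrite ?gt_eqF //.
apply: le_trans; rewrite mulrC.
have x8 : (1 - p / q) * (8 * s / eps) <= 8 * s.
  apply: le_trans (_ : eps * (8 * s / eps) <= _).
    by rewrite ler_wpM2r ?divr_ge0 ?mulr_ge0 ?(ltW e0).
  by apply: eq_ler; field; rewrite ?gt_eqF //.
have x0 : 0 <= (1 - p / q) * (8 * s / eps) by rewrite mulr_ge0 ?divr_ge0 ?mulr_ge0 ?(ltW e0).
apply: ler_pM; rewrite ?expR_ge0 //.
- by rewrite divr_ge0 ?(ltW e0) // !mulr_ge0 ?exprn_ge0 ?(ltW K0) ?(ltW A0).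
- rewrite ler_expR lerN2; set x := _ * (8 * s / eps) in x0 x8 *.
  have x64 : x ^+ 2 <= 64 * A.
    rewrite -sA (_ : 64 * s ^+ 2 = (8 * s) ^+ 2); last by ring.
    by rewrite lerXn2r // nnegrE // mulr_ge0.
  have K0' := ltW K0.
  apply: lerD; apply: ler_wpM2l; rewrite ?mulr_ge0 //.
  by apply: le_trans x8 _; rewrite ler_pM2l.
rewrite (_ : 64 * K ^+ 2 * (8 * s / eps) = (64 * K ^+ 2 * (8 * s)) / eps); last by rewrite !mulrA.
rewrite invf_div; apply: ler_wpM2l; first exact: ltW.
have s0' : 0 < s by apply: lt_le_trans s1.
rewrite lef_pV2 ?posrE ?mulr_gt0 ?exprn_gt0 //.
by apply: ler_wpM2l; rewrite ?mulr_ge0 ?exprn_ge0 ?ler_pM2l ?(ltW K0).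
Qed.

End LargeCluster.

(** * The critical window and the ordered cluster sizes *)

Section CriticalWindow.
Variables (R : realType) (G : sgraph) (m : nat) (o : G) (p1 pc : R).
Hypotheses (trG : vertex_transitive G) (regG : regular_of_degree G m).
Hypothesis m_ge4 : (4 <= m)%N.
Hypothesis nabla_le : forall p (a b : G), 0 <= p <= p1 -> adj a b -> nabla p a b <= 2^-1.
Hypotheses (p1_ge0 : 0 <= p1) (p1_le : p1 <= pc) (pc_le1 : pc <= 1).
Local Notation chi := (fun p : R => mean p o (fun n => n%:R)).

Let m_gt0 : (0 < m)%N. Proof. exact: leq_trans m_ge4. Qed.
Let m0 : 0 < m%:R :> R. Proof. by rewrite ltr0n. Qed.
Let p1_01 : 0 <= p1 <= 1. Proof. by rewrite p1_ge0 (le_trans p1_le). Qed.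

Lemma p1_gt0 : 2 <= chi p1 -> 0 < p1.
Proof.
move=> c2; have := degree_mul_ge trG regG p1_01 c2; have := m0 => M0 H.
have : 0 < m%:R * p1 by lra.
by rewrite pmulr_rgt0.
Qed.

(** The second moment is nondecreasing in the parameter, so its lower bound at [p1] persists up to
    [pc], while chi is at most lam t. OSSS with h = id then forces chi' to be at least of order t^2
    / pc, and chi cannot grow by more than lam t. *)
Lemma window_width (lam l1 t : R) : 0 < t -> 0 < lam -> 0 < l1 ->
  chi p1 = l1 * t -> chi pc = lam * t -> 2 <= chi p1 -> 32 * lam ^+ 2 <= l1 ^+ 3 * t ->
  pc - p1 <= pc * (64 * lam ^+ 2 / (l1 ^+ 3 * t)).
Proof.
move=> t0 lam0 l10 c1 cc c2 tbig; have p10 := p1_gt0 c2.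
have pc0 : 0 < pc by apply: lt_le_trans p1_le.
(* OSSS gives (l1 t)^3 / 16 <= chi^2 + 2 chi Y with Y = r (1 - r) chi' and chi <= lam t. By the last
   hypothesis chi^2 is at most half of the left side, which leaves Y >= X. *)
set X := l1 ^+ 3 * t ^+ 2 / (64 * lam).
have X0 : 0 < X by rewrite divr_gt0 ?mulr_gt0 ?exprn_gt0.
have dge r : p1 <= r <= pc -> X / pc <= dmean r o (fun n => n%:R).
  move=> /andP[pr rp]; have rr : 0 <= r <= 1 by rewrite (le_trans p1_ge0 pr) (le_trans rp).
  have := osss_mean o trG rr (h := fun n => n%:R) (@homo_natr R).
  have D0 := dmean_ge0 o rr (@homo_natr R).
  have chir : chi r <= lam * t by rewrite -cc; apply: mean_homo; rewrite ?(le_trans p1_ge0 pr) //; apply: homo_natr.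
  have chir0 : 0 < chi r by apply: chi_gt0.
  have m2 : (l1 * t) ^+ 3 <= 16 * mean r o (fun n => n%:R * n%:R).
    rewrite -c1; have pp : 0 <= p1 <= p1 by rewrite p1_ge0 lexx.
    apply: le_trans (chi2_ge trG regG m_gt0 p1_01 nabla_le m_ge4 pp c2) _.
    rewrite ler_pM2l //.
    apply: le_trans (mean_homo o (q := r) (h := fun n => n%:R ^+ 2) _ p1_ge0 pr _) _.
    - by move=> i j ij; rewrite -!natrX ler_nat leq_exp2r.
    - by case/andP: rr.
    by apply: eq_ler; apply: eq_bex => w _; rewrite expr2.
  move: D0 m2 chir chir0; rewrite /=; set D := dmean r o _; set M2 := mean r o (fun n => _ * _).
  set u := mean r o _ => D0 m2 chir chir0 H.
  rewrite ler_pdivrMr // [D * _]mulrC.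
  have rq : r * (1 - r) * D <= pc * D.
    apply: ler_wpM2r => //; apply: le_trans rp.
    by case/andP: rr => r0 r1; rewrite ler_piMr //; lra.
  apply: le_trans rq; set Y := r * (1 - r) * D in H *.
  have Y0 : 0 <= Y by case/andP: rr => r0 r1; rewrite !mulr_ge0 ?subr_ge0.
  have h1 : u * u <= (lam * t) * (lam * t) by apply: ler_pM => //; exact: ltW.
  have h2 : 2 * u * Y <= 2 * (lam * t) * Y by rewrite ler_wpM2r // ler_pM2l.
  have h3 : (32 * lam ^+ 2) * t ^+ 2 <= l1 ^+ 3 * t * t ^+ 2 by rewrite ler_wpM2r ?sqr_ge0.
  rewrite /X ler_pdivrMr ?mulr_gt0 // -(ler_pM2r t0).
  rewrite (_ : l1 ^+ 3 * t ^+ 2 * t = (l1 * t) ^+ 3); last by ring.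
  rewrite (_ : (32 * lam ^+ 2) * t ^+ 2 = 32 * ((lam * t) * (lam * t))) in h3; last by ring.
  rewrite (_ : l1 ^+ 3 * t * t ^+ 2 = (l1 * t) ^+ 3) in h3; last by ring.
  rewrite (_ : Y * (64 * lam) * t = 32 * (2 * (lam * t) * Y)); last by ring.
  lra.
have := is_derive_ge_le p1_le (fun r _ => is_derive_mean o (fun n => n%:R) r) dge.
have c10 : 0 < chi p1 by apply: chi_gt0.
move=> H; have {}H : X / pc * (pc - p1) <= lam * t.
  by apply: le_trans H _; rewrite -cc /= lerBlDr lerDl ltW.
rewrite mulrAC ler_pdivrMr // -ler_pdivlMl // in H.
apply: le_trans H _; apply: eq_ler.
by rewrite /X; field; rewrite ?gt_eqF.
Qed.

(** The window takes at most half of pc eps, so p1 - p >= pc eps / 2. Over this stretch 1 / chi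
    falls at rate at least m / 2, and 2 m pc >= 1 turns the fall into eps / 8. *)
Lemma near_critical (eps : R) : 0 < eps -> 2 <= chi p1 ->
  pc - p1 <= pc * (eps / 2) -> 0 <= pc * (1 - eps) ->
  pc * (1 - eps) <= p1 /\ chi (pc * (1 - eps)) <= 8 / eps.
Proof.
move=> e0 c2 w p0; have p10 := p1_gt0 c2.
have pc0 : 0 < pc by apply: lt_le_trans p1_le.
have d : pc * (eps / 2) <= p1 - pc * (1 - eps) by lra.
have pp1 : pc * (1 - eps) <= p1.
  by rewrite -subr_ge0; apply: le_trans d; rewrite mulr_ge0 ?divr_ge0 // ltW.
split=> //; set p := pc * (1 - eps) in p0 d pp1 *.
have g := chi_ge_growth o trG regG m_gt0 p1_01 nabla_le p0 pp1 (lexx p1).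
have mp := degree_mul_ge trG regG p1_01 c2.
have pp : 0 <= p <= 1 by rewrite p0 (le_trans pp1) //; case/andP: p1_01.
have c0 := chi_gt0 o pp; have c10 := chi_gt0 o p1_01.
move: g; set u := mean p o _ in c0 *; set u1 := mean p1 o _ in c10 * => g.
have i1 : 0 < u1^-1 by rewrite invr_gt0.
have mpc : m%:R * p1 <= m%:R * pc by rewrite ler_pM2l.
have h1 : m%:R / 2 * (pc * (eps / 2)) <= m%:R / 2 * (p - p + (p1 - p)).
  by rewrite ler_pM2l ?divr_gt0 // subrr add0r.
rewrite subrr add0r in h1.
have h2 : eps / 8 <= m%:R / 2 * (pc * (eps / 2)).
  rewrite (_ : m%:R / 2 * (pc * (eps / 2)) = 2 * (m%:R * pc) * (eps / 8)); last by field.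
  by rewrite ler_peMl ?divr_ge0 ?(ltW e0) //; lra.
have h3 : eps / 8 <= u^-1 by lra.
rewrite -[8 / eps]invf_div -[u]invrK lef_pV2 ?posrE ?invr_gt0 ?divr_gt0 //.
Qed.

End CriticalWindow.

(** * From tail bounds to the ordered cluster sizes *)

Lemma nth_sorted_geq (P : pred nat) (s : seq nat) (j : nat) :
  (forall a b, (a <= b)%N -> P a -> P b) -> sorted geq s ->
  (0 < j <= count P s)%N -> P (nth 0%N s j.-1).
Proof.
move=> mP; elim: s j => [|x s IH] j; first by move=> _ /= /andP[]; case: j.
rewrite /= => sx /andP[]; case: j => // -[|j] _ /= jc.
  have [//|nPx] := boolP (P x); rewrite (negbTE nPx) add0n -has_count in jc.
  have [y ys Py] := hasP jc; case/negP: nPx; apply: mP Py.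
  have tr : transitive geq by move=> a b c ab bc; apply: leq_trans ab.
  exact: (allP (order_path_min tr sx)).
apply: (IH j.+1); first exact: path_sorted sx.
by rewrite /=; case: (P x) jc => /=; [rewrite add1n ltnS | rewrite add0n => /ltnW].
Qed.

Section ClusterSize.
Variables (R : realType) (G : sgraph).
Implicit Types (w : {set {set G}}) (r M : R).

Lemma cluster_size_cases w j :
  cluster_size w j = 0%N \/ exists x, cluster_size w j = #|open_cluster w x|.
Proof.
rewrite /cluster_size; set s := sort _ _.
have [js|js] := ltnP j.-1 (size s); last by left; rewrite nth_default.
right; have : nth 0%N s j.-1 \in s by apply: mem_nth.
rewrite mem_sort => /mapP[A]; rewrite mem_enum => /imsetP[x _ ->] ->.
by exists x.
Qed.

Lemma count_large_clusters w r M : 0 <= M -> (forall x, #|open_cluster w x|%:R <= M) ->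
  \sum_(x : G) (r <= #|open_cluster w x|%:R)%R%:R <=
  #|[set A in open_clusters w | r <= #|A|%:R]%SET|%:R * M :> R.
Proof.
move=> M0 leM.
have -> : \sum_(x : G) (r <= #|open_cluster w x|%:R)%R%:R =
   \sum_(x in [set: G]%SET) (r <= #|open_cluster w x|%:R)%R%:R :> R.
  by apply: eq_bigl => x; rewrite finset.in_setT.
rewrite (partition_big_imset (open_cluster w)) /= -/(open_clusters w).
apply: le_trans (_ : _ <= \sum_(A in open_clusters w) (r <= #|A|%:R)%R%:R * M) _; last first.
  rewrite -mulr_suml ler_wpM2r // -sum1_card natr_sum.
  rewrite [leRHS]big_mkcond [leLHS]big_mkcond /=; apply: ler_sum => A _.
  by rewrite finset.inE; case: (A \in _); case: (r <= _).
apply: ler_sum => _ /imsetP[y _ ->].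
apply: le_trans (_ : _ <= \sum_(x in open_cluster w y) (r <= #|open_cluster w y|%:R)%R%:R) _.
  rewrite [leLHS]big_mkcond [leRHS]big_mkcond /=; apply: ler_sum => x _.
  rewrite finset.in_setT /=; case: eqP => [<-|_]; first by rewrite open_cluster_refl.
  by case: ifP.
rewrite sumr_const; case: (r <= _) => /=; last by rewrite mul0rn mul0r.
by rewrite mul1r; apply: leM.
Qed.

Lemma le_cluster_size w r M j : 0 < M -> (0 < j)%N ->
  (forall x, #|open_cluster w x|%:R <= M) ->
  j%:R * M <= \sum_(x : G) (r <= #|open_cluster w x|%:R)%R%:R ->
  r <= (cluster_size w j)%:R.
Proof.
move=> M0 j0 leM jM.
have := le_trans jM (count_large_clusters r (ltW M0) leM).
rewrite ler_pM2r // ler_nat => jc.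
apply: (@nth_sorted_geq (fun n => r <= n%:R)).
- by move=> a b ab ra; apply: le_trans ra _; rewrite ler_nat.
- by apply: sort_sorted => a b; apply: leq_total.
rewrite j0 count_sort count_map (leq_trans jc) //.
rewrite cardE -size_filter; apply: uniq_leq_size; first exact: enum_uniq.
by move=> A; rewrite mem_enum finset.inE mem_filter /= mem_enum andbC.
Qed.

Section Transitive.
Variables (o : G) (p : R).
Hypothesis trG : vertex_transitive G.
Hypothesis p01 : 0 <= p <= 1.
Local Notation E := (edges G).
Local Notation chi := (mean p o (fun n => n%:R)).
Local Notation V := (#|G|%:R : R).

(** One cluster above [M] already places at least [M] vertices in such clusters, so Markov's
    inequality for their number gains the factor 1 / M over a union bound. *)
Lemma prob_max_cluster M : 0 < M ->
  bex p E (fun w => [exists x, M < #|open_cluster w x|%:R]%:R) <= V * tail o p M / M.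
Proof.
move=> M0; rewrite ler_pdivlMr // -bexZr.
have -> : V * tail o p M = bex p E (fun w => \sum_(x : G) (M <= #|open_cluster w x|%:R)%R%:R).
  rewrite bex_sum (eq_bigr (fun=> tail o p M)) ?sum_vertices // => x _.
  exact: mean_transitive.
apply: le_bex => // w _; case: existsP => [[y yM]|_]; last by rewrite mul0r sumr_ge0.
rewrite mul1r; apply: le_trans (ltW yM) _; rewrite -sum_open_connected.
apply: ler_sum => x _; have [xy|//] := boolP (open_connected w y x).
by rewrite (open_cluster_eq (x := y) (y := x)) ?inE // (ltW yM).
Qed.

Lemma prob_few_vertices r : 0 < tail o p r ->
  bex p E (fun w => (\sum_(x : G) (r <= #|open_cluster w x|%:R)%R%:R < V * tail o p r / 2)%R%:R)
  <= 4 * chi / (V * tail o p r ^+ 2).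
Proof.
move=> t0; have V0 : 0 < V by apply: card_vertex_gt0.
set T := tail o p r in t0 *.
have var := count_variance o trG p01 (h := fun n => (r <= n%:R)%R%:R) _ (@tail_homo R r).
have {}var := var (fun n => _); rewrite -/(tail o p r) -/T in var.
have a2 : 0 < (V * T) ^+ 2 by rewrite exprn_gt0 // mulr_gt0.
rewrite (_ : 4 * chi / (V * T ^+ 2) = 4 * (V * chi) / (V * T) ^+ 2); last first.
  by field; rewrite !gt_eqF.
rewrite ler_pdivlMr // -bexZr.
apply: le_trans (_ : _ <= 4 * bex p E (fun w => (\sum_(x : G) (r <= #|open_cluster w x|%:R)%R%:R - V * T) ^+ 2)) _.
  rewrite -bexZ; apply: le_bex => // w _; set N := \sum_x _.
  have [h|h] := ltP N; last by rewrite mul0r mulr_ge0 // sqr_ge0.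
  rewrite mul1r (_ : 4 * (N - V * T) ^+ 2 = (2 * (V * T - N)) ^+ 2); last by ring.
  have VT : 0 < V * T by rewrite mulr_gt0.
  have := ltW VT; rewrite lerXn2r ?nnegrE //; lra.
rewrite ler_pM2l //; apply: le_trans (var _) _ => [n|].
  by rewrite ler0n lern1 leq_b1.
rewrite ler_pM2l //; apply: le_mean => // n.
by rewrite ler_piMr // lern1 leq_b1.
Qed.

Lemma cluster_size_prob r M j : 0 < M -> 0 < tail o p r -> (0 < j)%N ->
  j%:R * M <= V * tail o p r / 2 ->
  1 - V * tail o p M / M - 4 * chi / (V * tail o p r ^+ 2) <=
  bex p E (fun w => (r <= (cluster_size w j)%:R <= M)%R%:R).
Proof.
move=> M0 t0 j0 jM; have h1 := prob_max_cluster M0; have h2 := prob_few_vertices t0.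
rewrite -addrA -opprD lerBlDr -[leLHS](bex_cst p E).
apply: le_trans (_ : bex p E (fun w => (r <= (cluster_size w j)%:R <= M)%R%:R) +
  (bex p E (fun w => [exists x, M < #|open_cluster w x|%:R]%:R) +
   bex p E (fun w => (\sum_(x : G) (r <= #|open_cluster w x|%:R)%R%:R < V * tail o p r / 2)%R%:R)) <= _);
  last by rewrite lerD2l lerD.
rewrite -!bexD; apply: le_bex => // w _.
have [_|/existsPn nM] := boolP [exists x, M < #|open_cluster w x|%:R]; first by rewrite addrCA lerDl addr_ge0.
have {}nM x : #|open_cluster w x|%:R <= M by rewrite leNgt nM.
have [_|h] := ltP (\sum_(x : G) (r <= #|open_cluster w x|%:R)%R%:R) (V * tail o p r / 2).
  by rewrite addrA lerDr addr_ge0.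
rewrite (le_cluster_size M0 j0 nM (le_trans jM h)) /= !addr0.
by have [->|[x ->]] := cluster_size_cases w j; rewrite ?(ltW M0) ?nM.
Qed.

End Transitive.
End ClusterSize.

(** * Asymptotics *)

Section NearCriticalGraph.
Variables (R : realType) (G : sgraph) (m : nat) (o : G) (pc lam l1 t K : R).
Hypotheses (trG : vertex_transitive G) (regG : regular_of_degree G m).
Hypothesis m_ge4 : (4 <= m)%N.
Local Notation E := (edges G).
Local Notation V := (#|G|%:R : R).
Local Notation chi := (fun p : R => mean p o (fun n => n%:R)).
Hypotheses (pc_01 : 0 <= pc <= 1) (chi_pc : chi pc = lam * t).
Hypotheses (l1_gt0 : 0 < l1) (l1_lam : l1 <= lam).
Hypothesis nabla_le : forall p (a b : G), 0 <= p <= pc -> chi p <= l1 * t ->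
  adj a b -> nabla p a b <= 2^-1.
Hypotheses (K_ge4 : 4 <= K) (K_exp : 40 * expR (- (K / 32)) <= 64^-1).

Variables (eps : R).
Hypotheses (eps_gt0 : 0 < eps) (eps_le : eps <= 2^-1).
Hypotheses (eps_t1 : 128 * lam ^+ 2 / l1 ^+ 3 <= eps * t) (eps_t2 : 16 / l1 <= eps * t).
Hypothesis t_gt0 : 0 < t.
Local Notation p := (pc * (1 - eps)).

Let lam_gt0 : 0 < lam. Proof. exact: lt_le_trans l1_lam. Qed.

Let t_big : eps * t <= t / 2.
Proof. by have := t_gt0; have := eps_le; nra. Qed.

Let l1_t : 32 <= l1 * t.
Proof.
have : 16 <= eps * t * l1 by rewrite -ler_pdivrMr.
by have := ler_wpM2r (ltW l1_gt0) t_big; lra.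
Qed.

(** [p1] comes from the intermediate value theorem. Hypothesis [eps_t1] makes the window above [p1]
    at most half of pc eps; [eps_t2] leaves room above p for the susceptibility to double. *)
Lemma subcritical_window : exists p1, [/\ 0 < p, p <= p1 /\ p1 <= pc, chi p1 = l1 * t,
  chi p <= 8 / eps & forall q (a b : G), 0 <= q <= p1 -> adj a b -> nabla q a b <= 2^-1].
Proof.
case/andP: pc_01 => pc0 pc1.
have [|p1 /andP[p10 p1c] cp1] := @mean_IVT R G o 0 pc (l1 * t) (lexx 0) pc0 pc1.
  rewrite mean0 chi_pc ler_pM2r ?l1_lam ?andbT //; have := l1_t; lra.
have nab q (a b : G) : 0 <= q <= p1 -> adj a b -> nabla q a b <= 2^-1.
  move=> /andP[q0 qp] ab; apply: nabla_le => //; first by rewrite q0 (le_trans qp).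
  rewrite -cp1; apply: mean_homo => //; first exact: homo_natr.
  exact: le_trans pc1.
have c2 : 2 <= chi p1 by rewrite /= cp1; have := l1_t; lra.
have p1pos : 0 < p1 by apply: (p1_gt0 trG regG m_ge4 p10 p1c pc1 c2).
have pcpos : 0 < pc by apply: lt_le_trans p1c.
have l3 : 0 < l1 ^+ 3 by rewrite exprn_gt0.
have lt : 128 * lam ^+ 2 <= eps * t * l1 ^+ 3 by rewrite -ler_pdivrMr.
have w : pc - p1 <= pc * (eps / 2).
  apply: le_trans (window_width trG regG m_ge4 nab p10 p1c pc1 t_gt0 lam_gt0 l1_gt0 cp1 chi_pc c2 _) _.
    have := ler_wpM2r (ltW l3) t_big; have := sqr_ge0 lam; rewrite [_ * t]mulrC; lra.
  rewrite ler_pM2l // ler_pdivrMr ?mulr_gt0 //.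
  by rewrite (_ : eps / 2 * (l1 ^+ 3 * t) = eps * t * l1 ^+ 3 / 2); [lra | ring].
have p0 : 0 < p by rewrite mulr_gt0 //; have := eps_le; lra.
have [pp1 cp] := near_critical trG regG m_ge4 nab p10 p1c pc1 eps_gt0 c2 w (ltW p0).
by exists p1.
Qed.

Lemma subcritical_param : 0 <= p <= 1.
Proof.
have [p1 [p0 [pp1 p1c] _ _ _]] := subcritical_window; case/andP: pc_01 => _ pc1.
by rewrite (ltW p0) (le_trans (le_trans pp1 p1c)).
Qed.

Lemma chi_subcritical : chi p <= 8 / eps.
Proof. by have [p1 []] := subcritical_window. Qed.

Lemma tail_subcritical_le N : 32 / eps <= N ->
  tail o p N <= 16 / (eps * N) * expR (- (N * eps ^+ 2 / (32 * 64))).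
Proof.
move=> N32; have [p1 [p0 [pp1 p1c] cp1 cp nab]] := subcritical_window.
case/andP: pc_01 => pc0 pc1.
have p1_01 : 0 <= p1 <= 1 by rewrite (le_trans (ltW p0)) // (le_trans p1c).
have m_gt0 : (0 < m)%N by apply: leq_trans m_ge4.
have N0 : 0 < N by apply: lt_le_trans N32; rewrite divr_gt0.
have c0 : 0 < chi p by apply: chi_gt0; apply: subcritical_param.
have c8 : 2 * chi p <= chi p1.
  rewrite /= cp1; apply: le_trans (_ : 16 / eps <= _); first by move: cp; rewrite /=; lra.
  rewrite ler_pdivrMr //; have : 16 <= eps * t * l1 by rewrite -ler_pdivrMr.
  by rewrite (_ : l1 * t * eps = eps * t * l1) //; ring.
apply: le_trans (tail_le trG regG m_gt0 p1_01 nab p0 pp1 c8 _) _.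
  by apply: le_trans N32; move: cp; rewrite /=; lra.
move: c0 cp; rewrite /=; set u := mean p o _ => c0 cp.
apply: ler_pM; rewrite ?expR_ge0 ?divr_ge0 ?mulr_ge0 ?(ltW c0) ?(ltW N0) //.
  rewrite (_ : 16 / (eps * N) = 2 * (8 / eps) / N); last by field; rewrite !gt_eqF.
  by rewrite ler_pM2r ?invr_gt0 // ler_pM2l.
rewrite ler_expR lerN2.
have -> : N * eps ^+ 2 / (32 * 64) = N / (32 * (8 / eps) ^+ 2) by field; rewrite gt_eqF.
rewrite ler_pM2l // lef_pV2 ?posrE ?mulr_gt0 ?exprn_gt0 ?mulr_gt0 ?invr_gt0 //.
by rewrite ler_pM2l // lerXn2r ?nnegrE ?divr_ge0 // ltW.
Qed.

Lemma tail_subcritical_ge A : 1 <= A -> 16 * A <= l1 * (eps * t) ->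
  eps / (64 * K ^+ 2 * 8) / A * expR (- ((8 * K * 64 + 36 * K * 8) * A))
    <= tail o p (A / eps ^+ 2).
Proof.
move=> A1 Ae; have [p1 [p0 [pp1 p1c] cp1 cp nab]] := subcritical_window.
case/andP: pc_01 => pc0 pc1.
have p1_01 : 0 <= p1 <= 1 by rewrite (le_trans (ltW p0)) // (le_trans p1c).
have e12 : 0 < eps <= 2^-1 by rewrite eps_gt0.
have := tail_ge trG regG m_ge4 p1_01 nab K_ge4 K_exp p1c erefl e12 p0 pp1 cp A1.
rewrite /= cp1 => /(_ _) H.
have {}H := H _; apply: le_trans (H _); last by rewrite mulrCA.
have K0 : 0 < K by apply: lt_le_trans K_ge4.
have A0 : 0 < A by apply: lt_le_trans A1.
apply: eq_ler; congr (_ * expR (- _)); last by ring.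
by field; rewrite !gt_eqF.
Qed.

Variables (L alpha c' : R) (j : nat).
Hypotheses (L_def : V * eps ^+ 3 = expR L) (L_ge1 : 1 <= L).
Hypotheses (c'_gt0 : 0 < c') (j_ge1 : (0 < j)%N) (j_le : j%:R <= expR (alpha * L)).
Local Notation ca := (8 * K * 64 + 36 * K * 8).
Local Notation D := (64 * K ^+ 2 * 8).
Hypotheses (ca_c' : ca * c' <= 4^-1) (alpha_c' : ca * c' <= (1 - alpha) / 2).
Hypotheses (L1 : 1 <= c' * L) (L2 : 16 * c' * L <= l1 * (eps * t)).
Hypothesis L3 : 2 * D * c' * (32 * 64) * L ^+ 2 <= expR ((1 - alpha) / 2 * L).

(** The first error bounds the probability of a cluster that is too large, the second is Chebyshev's
    bound for the number of vertices in clusters above the lower threshold. The two smallness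
    conditions on [c'] keep that number above j M and make the second error decay. *)
Lemma cluster_size_subcritical :
  1 - 16 / L - 32 * D ^+ 2 * c' ^+ 2 * L ^+ 2 * expR (- (2^-1 * L)) <=
  bex p E (fun w => (c' * (eps ^- 2 * L) <= (cluster_size w j)%:R <= 32 * 64 * (eps ^- 2 * L))%R%:R).
Proof.
have K0 : 0 < K by apply: lt_le_trans K_ge4.
have D0 : 0 < D by rewrite !mulr_gt0 ?exprn_gt0.
have L0 : 0 < L by apply: lt_le_trans L_ge1.
have V0 : 0 < V by apply: card_vertex_gt0.
(* The factor matches the exponent in [tail_subcritical_le], so that the tail at [M] carries exp (-
   L) = 1 / (V eps^3). *)
set M := 32 * 64 * (eps ^- 2 * L); set r := c' * (eps ^- 2 * L).
have M0 : 0 < M by rewrite /M !mulr_gt0 // invr_gt0 exprn_gt0.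
have rE : r = c' * L / eps ^+ 2 by rewrite /r mulrA mulrAC.
have tr : eps / (D * (c' * L)) * expR (- (ca * c' * L)) <= tail o p r.
  rewrite rE; have L2' : 16 * (c' * L) <= l1 * (eps * t) by rewrite mulrA.
  have := tail_subcritical_ge L1 L2'.
  apply: le_trans; apply: eq_ler.
  by rewrite [in RHS]mulrA -[eps / D / _]mulrA -invfM.
set T := eps / _ * _ in tr.
have T0 : 0 < T by rewrite /T mulr_gt0 ?expR_gt0 // divr_gt0 // !mulr_gt0.
have t0 : 0 < tail o p r by apply: lt_le_trans tr.
have jM : j%:R * M <= V * tail o p r / 2.
  apply: le_trans (_ : V * T / 2 <= _); last by rewrite ler_pM2r // ler_pM2l.
  apply: le_trans (ler_wpM2r (ltW M0) j_le) _.
  have -> : V * T / 2 = expR L * expR (- (ca * c' * L)) * (eps ^- 2 / (2 * D * (c' * L))).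
    by rewrite -L_def /T; field; rewrite !gt_eqF.
  rewrite -expRD.
  (* Half of the gap (1 - alpha) L pays for exp (- ca c' L); the other half absorbs the polynomial
     factors through [L3]. *)
  apply: le_trans (_ : expR (alpha * L + (1 - alpha) / 2 * L) * (eps ^- 2 / (2 * D * (c' * L))) <= _).
    rewrite expRD -mulrA ler_pM2l ?expR_gt0 //.
    have -> : M = eps ^- 2 * (32 * 64 * L) by rewrite /M mulrCA.
    rewrite [leRHS]mulrCA ler_pM2l ?invr_gt0 ?exprn_gt0 //.
    rewrite ler_pdivlMr ?mulr_gt0 //; apply: le_trans L3; apply: eq_ler.
    ring.
  rewrite ler_pM2r; last by rewrite divr_gt0 ?invr_gt0 ?exprn_gt0 ?mulr_gt0.
  rewrite ler_expR; have := ler_wpM2r (ltW L0) alpha_c'; lra.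
apply: (le_trans _ (cluster_size_prob trG subcritical_param M0 t0 j_ge1 jM)).
rewrite -!addrA lerD2l -!opprD lerN2; apply: lerD.
  have Me : 32 / eps <= M.
    rewrite /M ler_pdivrMr // (_ : 32 * 64 * (eps ^- 2 * L) * eps = 32 * (64 * (L / eps))); last first.
      by field; rewrite gt_eqF.
    rewrite ler_peMr //; have : 1 <= L / eps; last by lra.
    by rewrite ler_pdivlMr //; have := eps_le; have := L_ge1; lra.
  rewrite ler_pdivrMr //; apply: le_trans (ler_wpM2l (ltW V0) (tail_subcritical_le Me)) _.
  have -> : M * eps ^+ 2 / (32 * 64) = L by rewrite /M; field; rewrite gt_eqF.
  have -> : V * (16 / (eps * M) * expR (- L)) = 16 / (eps ^+ 4 * M).
    rewrite expRN -L_def; field; rewrite !gt_eqF //.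
  rewrite ler_pdivrMr; last by apply: mulr_gt0; rewrite ?exprn_gt0.
  rewrite /M.
  have -> : 16 / L * (32 * 64 * (eps ^- 2 * L)) * (eps ^+ 4 * (32 * 64 * (eps ^- 2 * L))) =
     16 * ((32 * 64) * ((32 * 64) * L)) by field; rewrite !gt_eqF.
  by rewrite ler_peMr // !mulr_ege1 ?ler1n.
apply: le_trans (_ : 4 * (8 / eps) / (V * T ^+ 2) <= _).
  apply: ler_pM.
  - by rewrite mulr_ge0 // mean_ge0 // subcritical_param.
  - by rewrite invr_ge0 mulr_ge0 // sqr_ge0.
  - by rewrite ler_pM2l //; apply: chi_subcritical.
  have VT0 : 0 < V * T ^+ 2 := mulr_gt0 V0 (exprn_gt0 2 T0).
  have Vt0 : 0 < V * tail o p r ^+ 2 := mulr_gt0 V0 (exprn_gt0 2 t0).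
  rewrite lef_pV2 ?posrE // ler_pM2l //.
  by rewrite lerXn2r ?nnegrE ?(ltW T0) ?(ltW t0).
have -> : 4 * (8 / eps) / (V * T ^+ 2) =
   32 * D ^+ 2 * c' ^+ 2 * L ^+ 2 * (expR (- L) * expR (ca * c' * L) ^+ 2).
  rewrite /T !expRN -L_def; field; rewrite !gt_eqF ?expR_gt0 //.
rewrite ler_pM2l; last by rewrite !mulr_gt0 ?exprn_gt0.
(* The tail enters squared, and ca c' <= 1/4 leaves exp (- L + L / 2). *)
rewrite -expRM_natl -expRD ler_expR.
have := ler_wpM2r (ltW L0) ca_c'; lra.
Qed.

End NearCriticalGraph.

Lemma cube_le_exp (R : realType) (k x : R) : 0 <= k -> 0 <= x ->
  (k * x / 3) ^+ 3 <= expR (k * x).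
Proof.
move=> k0 x0; have kx0 : 0 <= k * x / 3 by rewrite divr_ge0 // mulr_ge0.
rewrite (_ : k * x = 3%:R * (k * x / 3)) ?expRM_natl; last by field.
rewrite (_ : 3%:R * (k * x / 3) / 3 = k * x / 3); last by field.
rewrite lerXn2r ?nnegrE ?expR_ge0 //; apply: le_trans (expR_ge1Dx _).
by rewrite lerDr.
Qed.

Lemma cube_root_card (R : realType) (n : nat) : ((n%:R : R) `^ 3^-1) ^+ 3 = n%:R.
Proof. by rewrite -powR_mulrn ?powR_ge0 // -powRrM mulVf // powRr1. Qed.

Theorem theorem1p6 (R : realType) (m0 : nat) (G : nat -> sgraph)
    (o : forall m, G m) (lambda : R) (pc eps : nat -> R)
    (m0_gt0 : (0 < m0)%N)
    (lambda_gt0 : 0 < lambda)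
    (G_transitive : forall m, (m0 <= m)%N -> vertex_transitive (G m))
    (G_regular : forall m, (m0 <= m)%N -> regular_of_degree (G m) m)
    (pc_critical : forall m, (m0 <= m)%N -> is_critical lambda (o m) (pc m))
    (G_triangle : strong_triangle m0 o pc)
    (eps_ge0 : forall m, (m0 <= m)%N -> 0 <= eps m)
    (eps_cvg0 : eps m @[m --> \oo] --> (0 : R))
    (epsV_cvgy : eps m ^+ 3 * #|G m|%:R @[m --> \oo] --> +oo) :
  let p := fun m => pc m * (1 - eps m) in
  let scale := fun m => eps m ^- 2 * ln (eps m ^+ 3 * #|G m|%:R) in
  (forall (alpha : R) (j : nat -> nat), alpha < 1 ->
     (\forall m \near \oo,
        (1 <= j m)%N /\ (j m)%:R <= (eps m ^+ 3 * #|G m|%:R) `^ alpha) ->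
     exists c' C' : R,
       0 < c' <= C' /\
       prob (p m) (fun w : {set {set G m}} =>
         c' * scale m <= (cluster_size w (j m))%:R <= C' * scale m)
         @[m --> \oo] --> (1 : R))
  /\
  (exists c ca : R,
     [/\ 0 < c, 0 < ca &
       forall (m : nat) (A : R), (m0 <= m)%N ->
         1 <= A <= c * eps m * #|G m|%:R `^ 3^-1 ->
         c * eps m / A * expR (- (ca * A)) <=
         prob (p m) (fun w : {set {set G m}} =>
           A * eps m ^- 2 <= #|open_cluster w (o m)|%:R)]).
Proof.
move=> p scale; have [C C0 HC] := G_triangle.
pose V m : R := #|G m|%:R; pose t m : R := V m `^ 3^-1.
have V0 m : 0 < V m by apply: card_vertex_gt0.
have t0 m : 0 < t m by rewrite powR_gt0.
have tV m : t m ^+ 3 = V m by apply: cube_root_card.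
(* As l1 <= 1, C l1^3 <= C l1 <= C / (1 + 4 C) <= 1/4. Together with C / m <= 1/4 this gives the
   bound 1/2 on the triangle. *)
pose l1 := Num.min lambda (1 + 4 * C)^-1.
have i0 : 0 < (1 + 4 * C)^-1 by rewrite invr_gt0; lra.
have l10 : 0 < l1 by rewrite lt_min lambda_gt0.
have l1_lam : l1 <= lambda by rewrite ge_min lexx.
have l1_C : C * l1 ^+ 3 <= 4^-1.
  have l1i : l1 <= (1 + 4 * C)^-1 by rewrite ge_min lexx orbT.
  have l1_le1 : l1 <= 1 by apply: le_trans l1i _; rewrite invf_le1; lra.
  have l13 : l1 ^+ 3 <= l1.
    by rewrite exprS ler_piMr ?(ltW l10) // expr2 mulr_ile1 ?(ltW l10).
  have Cl : C * l1 ^+ 3 <= C * (1 + 4 * C)^-1 by rewrite ler_pM2l //; apply: le_trans l1i.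
  by apply: le_trans Cl _; rewrite ler_pdivrMr; lra.
have [K K4 Kexp] : exists2 K : R, 4 <= K & 40 * expR (- (K / 32)) <= 64^-1.
  exists (32 * (40 * 64)); first by rewrite -[4]mulr1 ler_pM ?mulr_ege1 ?ler1n ?ler_nat.
  rewrite [32 * _]mulrC mulfK // expRN -ler_pdivlMl // -invfM lef_pV2 ?posrE ?expR_gt0 ?mulr_gt0 //.
  by apply: le_trans (expR_ge1Dx _); rewrite lerDr.
pose Gam := Num.max (128 * lambda ^+ 2 / l1 ^+ 3) (16 / l1).
have Gam0 : 0 <= Gam by rewrite le_max; apply/orP; right; rewrite divr_ge0 // ltW.
pose y m := eps m ^+ 3 * V m.
have yE m : y m = (eps m * t m) ^+ 3 by rewrite exprMn tV.
have [M1 HM1] : exists M1, forall m, (M1 <= m)%N ->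
    [/\ (m0 <= m)%N, (4 <= m)%N, 4 * C <= m%:R, 0 < eps m <= 2^-1 & Gam <= eps m * t m].
  have e2 : 0 < (2^-1 : R) by rewrite invr_gt0.
  have /cvgrPdist_le/(_ _ e2)[Na _ Ha] := eps_cvg0.
  (* Adding 1 makes the bound positive, which rules out [eps m = 0]. *)
  have /cvgryPge/(_ (Gam ^+ 3 + 1))[Nb _ Hb] := epsV_cvgy.
  have [Nc Hc] : exists N : nat, 4 * C <= N%:R.
    exists (Num.bound (4 * C)); apply: ltW; apply: archi_boundP.
    by rewrite mulr_ge0 // ltW.
  exists (maxn m0 (maxn 4 (maxn Na (maxn Nb Nc)))) => m.
  rewrite !geq_max => /and5P[h1 h2 h3 h4 h5].
  have ye : Gam ^+ 3 + 1 <= y m := Hb m h4.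
  have eps2 : eps m <= 2^-1.
    by have := Ha m h3; rewrite /= sub0r normrN => /(le_trans (ler_norm _)).
  have G3 : 0 <= Gam ^+ 3 by rewrite exprn_ge0.
  have epsn0 : eps m != 0.
    by apply: contraTneq ye => e0; rewrite /y e0 expr0n mul0r -ltNge; lra.
  have eps0 : 0 < eps m by rewrite lt_def epsn0 eps_ge0.
  split=> //; first by apply: le_trans Hc _; rewrite ler_nat.
    by rewrite eps0.
  have et0 : 0 <= eps m * t m by rewrite mulr_ge0 // ltW.
  by rewrite -(@ler_pXn2r _ 3) ?nnegrE // -yE; lra.
have nab m : (M1 <= m)%N -> forall q (a b : G m), 0 <= q <= pc m ->
    mean q (o m) (fun n => n%:R) <= l1 * t m -> adj a b -> nabla q a b <= 2^-1.
  move=> Mm q a b qpc cq ab; have [hm0 m4 mC _ _] := HM1 m Mm.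
  apply: le_trans (HC m a b q hm0 qpc) _.
  have /negbTE -> : a != b by apply: contraTneq ab => ->; rewrite adj_irrefl.
  rewrite add0r mulrDr.
  have mpos : 0 < m%:R :> R by rewrite ltr0n (leq_trans _ m4).
  have h1 : C / m%:R <= 4^-1 by rewrite ler_pdivrMr //; lra.
  have c0 : 0 <= mean q (o m) (fun n => n%:R : R).
    apply: mean_ge0 => //; have [/andP[_ pc1] _] := pc_critical m hm0.
    by case/andP: qpc => -> /le_trans; apply.
  have h2 : C * (mean q (o m) (fun n => n%:R) ^+ 3 / V m) <= 4^-1.
    apply: le_trans l1_C; rewrite ler_pM2l // ler_pdivrMr //.
    rewrite -tV -exprMn lerXn2r ?nnegrE // mulr_ge0 //; exact: ltW.
  have -> : 2^-1 = 4^-1 + 4^-1 :> R by field.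
  exact: lerD.
have G1 m : (M1 <= m)%N -> 128 * lambda ^+ 2 / l1 ^+ 3 <= eps m * t m.
  by move=> Mm; have [_ _ _ _] := HM1 m Mm; apply: le_trans; rewrite le_max lexx.
have G2 m : (M1 <= m)%N -> 16 / l1 <= eps m * t m.
  by move=> Mm; have [_ _ _ _] := HM1 m Mm; apply: le_trans; rewrite le_max lexx orbT.
have K0 : 0 < K by apply: lt_le_trans K4.
pose ca := 8 * K * 64 + 36 * K * 8; pose D := 64 * K ^+ 2 * 8.
have ca0 : 0 < ca by rewrite addr_gt0 // !mulr_gt0.
have D0 : 0 < D by rewrite !mulr_gt0 // exprn_gt0.
split.
  move=> alpha j alpha1 Hj.
  pose cc : R := 32 * 64.
  have cc1 : 1 <= cc by rewrite mulr_ege1 // ler1n.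
  (* The cap [cc] ensures c' <= C'; the other two are the smallness conditions of
     [cluster_size_subcritical]. *)
  pose c' := Num.min cc (Num.min (4^-1 / ca) ((1 - alpha) / 2 / ca)).
  have a0 : 0 < (1 - alpha) / 2 by rewrite divr_gt0 // subr_gt0.
  have c'0 : 0 < c'.
    by rewrite !lt_min (lt_le_trans ltr01 cc1) !divr_gt0 // subr_gt0.
  have c'cc : c' <= cc by rewrite ge_min lexx.
  have c'1 : ca * c' <= 4^-1.
    by rewrite mulrC -ler_pdivlMr // !ge_min lexx !orbT.
  have c'2 : ca * c' <= (1 - alpha) / 2.
    by rewrite mulrC -ler_pdivlMr // !ge_min lexx !orbT.
  exists c', cc; split; first by rewrite c'0.
  pose L m := ln (y m).
  (* The total error is at most kap / L, because exp (L / 2) >= (L / 6)^3 and 6^3 = 27 * 8. *)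
  pose kap := 16 + 32 * D ^+ 2 * c' ^+ 2 * (27 * 8).
  have kap0 : 0 < kap by rewrite addr_gt0 // !mulr_gt0 // exprn_gt0.
  pose be := ((1 - alpha) / 2 / 3) ^+ 3.
  have be0 : 0 < be by rewrite exprn_gt0 // divr_gt0.
  apply/cvgrPdist_le => e e0.
  (* Each summand secures one requirement on L: [L_ge1], [L1], [L2], [L3], and an error at most [e].
     The factor 9 * 9 * 9 comes from eps t = exp (L / 3) >= (L / 9)^3. *)
  pose Lam := 1 + c'^-1 + 16 * c' * (9 * 9 * 9) / l1 + 2 * D * c' * cc / be + kap / e.
  have [pos1 pos2 pos3 pos4] : [/\ 0 < c'^-1, 0 < 16 * c' * (9 * 9 * 9) / l1,
      0 < 2 * D * c' * cc / be & 0 < kap / e].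
    have cc0 : 0 < cc := lt_le_trans ltr01 cc1.
    split; [by rewrite invr_gt0 | | | exact: divr_gt0]; apply: divr_gt0 => //.
      by rewrite !mulr_gt0.
    by apply: mulr_gt0 cc0; apply: mulr_gt0 c'0; apply: mulr_gt0 D0.
  have /cvgryPge/(_ (expR Lam))[N1 _ HN1] := epsV_cvgy.
  have [N2 _ HN2] := Hj.
  exists (maxn M1 (maxn N1 N2)) => // m; rewrite /= !geq_max => /and3P[Mm N1m N2m].
  have [hm0 m4 mC eps02 _] := HM1 m Mm; case/andP: eps02 => eps0 eps2.
  have [j1 jle] := HN2 m N2m.
  have yL : expR Lam <= y m := HN1 m N1m.
  have y0 : 0 < y m by apply: lt_le_trans yL; apply: expR_gt0.
  have yexp : y m = expR (L m) by rewrite lnK.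
  have LL : Lam <= L m by rewrite -ler_expR -yexp.
  have [l_1 l_2 l_3 l_4] : [/\ 1 <= L m, c'^-1 <= L m, 16 * c' * (9 * 9 * 9) / l1 <= L m &
      2 * D * c' * cc / be <= L m].
    by rewrite /Lam in LL; split; lra.
  have l_5 : kap / e <= L m by rewrite /Lam in LL; lra.
  have L0 : 0 < L m by apply: lt_le_trans l_1.
  have [pc01 cpc] := pc_critical m hm0.
  have et0 : 0 < eps m * t m by rewrite mulr_gt0.
  have etL : eps m * t m = expR (3^-1 * L m).
    apply: (@pexpIrn _ 3); rewrite ?nnegrE ?expR_ge0 ?(ltW et0) //.
    by rewrite -yE yexp -expRM_natl mulVKf.
  have Ldef : V m * eps m ^+ 3 = expR (L m) by rewrite -yexp /y mulrC.
  have jL : (j m)%:R <= expR (alpha * L m).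
    by rewrite mulrC expRM -yexp.
  have L1' : 1 <= c' * L m by rewrite -ler_pdivrMl // mulr1.
  have L2' : 16 * c' * L m <= l1 * (eps m * t m).
    have h3 : 0 <= (3^-1 : R) by rewrite invr_ge0.
    have := cube_le_exp h3 (ltW L0); rewrite -etL => H; apply: le_trans (ler_wpM2l (ltW l10) H).
    have -> : l1 * (3^-1 * L m / 3) ^+ 3 = l1 * L m / (9 * 9 * 9) * L m * L m by field.
    rewrite ler_pM2r //.
    have h : 16 * c' <= l1 * L m / (9 * 9 * 9).
      by rewrite ler_pdivlMr // -ler_pdivrMl // mulrC.
    by apply: le_trans h _; rewrite ler_peMr // !mulr_ge0 ?invr_ge0 ?mulr_ge0 // ltW.
  have L3' : 2 * D * c' * cc * L m ^+ 2 <= expR ((1 - alpha) / 2 * L m).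
    apply: le_trans (cube_le_exp (ltW a0) (ltW L0)).
    have -> : ((1 - alpha) / 2 * L m / 3) ^+ 3 = be * L m * L m ^+ 2 by rewrite /be; field.
    by rewrite ler_pM2r ?exprn_gt0 // -ler_pdivrMl // mulrC.
  have key := cluster_size_subcritical (G_transitive m hm0) (G_regular m hm0) m4 pc01 cpc
    l10 l1_lam (nab m Mm) K4 Kexp eps0 eps2 (G1 m Mm) (G2 m Mm) (t0 m) Ldef l_1 c'0 j1 jL
    c'1 c'2 L1' L2' L3'.
  have {}key : 1 - 16 / L m - 32 * D ^+ 2 * c' ^+ 2 * L m ^+ 2 * expR (- (2^-1 * L m)) <=
      prob (p m) (fun w : {set {set G m}} =>
        c' * scale m <= (cluster_size w (j m))%:R <= cc * scale m) := key.
  have p01 := subcritical_param (G_transitive m hm0) (G_regular m hm0) m4 pc01 cpc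
    l10 l1_lam (nab m Mm) eps0 eps2 (G1 m Mm) (G2 m Mm) (t0 m).
  have P1 : prob (p m) (fun w : {set {set G m}} =>
     c' * scale m <= (cluster_size w (j m))%:R <= cc * scale m) <= 1.
    rewrite -[leRHS](bex_cst (p m) (edges (G m))); apply: le_bex => // w _.
    by rewrite lern1 leq_b1.
  rewrite ger0_norm ?subr_ge0 // lerBlDr -lerBlDl; apply: le_trans key.
  have hh : 32 * D ^+ 2 * c' ^+ 2 * L m ^+ 2 * expR (- (2^-1 * L m)) <=
      32 * D ^+ 2 * c' ^+ 2 * (27 * 8) / L m.
    rewrite -[leLHS]mulrA -[leRHS]mulrA.
    apply: ler_wpM2l.
      by apply: mulr_ge0; [apply: mulr_ge0 => //|]; apply: sqr_ge0.
    have h2 : 0 <= (2^-1 : R) by rewrite invr_ge0.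
    have := cube_le_exp h2 (ltW L0) => H.
    rewrite expRN ler_pdivrMr ?expR_gt0 //.
    have -> : L m ^+ 2 = 27 * 8 / L m * (2^-1 * L m / 3) ^+ 3 by field; rewrite gt_eqF.
    by rewrite ler_wpM2l // divr_ge0 ?mulr_ge0 // ltW.
  have kL : kap / L m <= e.
    by rewrite ler_pdivrMr // mulrC -ler_pdivrMr.
  rewrite /kap mulrDl in kL; lra.
(* For the finitely many m < M1 the assertion is made vacuous: c <= 1 / (1 + B) gives c eps t < 1,
   so no A >= 1 is admissible. *)
pose B := \sum_(m < M1) `|eps m * t m|.
have B0 : 0 <= B by apply: sumr_ge0 => m _; apply: normr_ge0.
(* For the other m, [l1 / 16] yields the range of [A] in [tail_subcritical_ge] and [D^-1] is its
   prefactor. *)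
pose c := Num.min (Num.min (l1 / 16) D^-1) (1 + B)^-1.
have c0 : 0 < c by rewrite !lt_min !divr_gt0 // !invr_gt0 D0 /=; lra.
exists c, ca; split=> // m A hm0 /andP[A1 Ac].
have cB : c <= (1 + B)^-1 by rewrite ge_min lexx orbT.
have cl : c <= l1 / 16 by rewrite !ge_min lexx.
have cD : c <= D^-1 by rewrite !ge_min lexx !orbT.
have [mM|Mm] := ltnP m M1.
  have eB : eps m * t m <= B.
    apply: le_trans (ler_norm _) _; rewrite /B (bigD1 (Ordinal mM)) //= lerDl.
    by apply: sumr_ge0 => i _; apply: normr_ge0.
  have : 1 <= c * (eps m * t m) by rewrite mulrA; apply: le_trans Ac.
  have : c * (eps m * t m) <= c * B by rewrite ler_pM2l.
  have : c * B <= (1 + B)^-1 * B by rewrite ler_wpM2r.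
  have : (1 + B)^-1 * B < 1 by rewrite mulrC ltr_pdivrMr; lra.
  lra.
have [_ m4 mC eps02 _] := HM1 m Mm; case/andP: eps02 => eps0 eps2.
have [pc01 cpc] := pc_critical m hm0.
have A0 : 0 < A by apply: lt_le_trans A1.
have A2 : 16 * A <= l1 * (eps m * t m).
  have et0 : 0 <= eps m * t m by rewrite mulr_ge0 // ltW.
  have := ler_wpM2r et0 cl; rewrite mulrA => h.
  have := le_trans Ac h; lra.
have key := tail_subcritical_ge (G_transitive m hm0) (G_regular m hm0) m4 pc01 cpc
    l10 l1_lam (nab m Mm) K4 Kexp eps0 eps2 (G1 m Mm) (G2 m Mm) (t0 m) A1 A2.
apply: le_trans key; rewrite ler_pM2r ?expR_gt0 // ler_pM2r ?invr_gt0 //.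
by rewrite mulrC ler_pM2l.
Qed.
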